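(* Let $m\ge0$. The map $V_1\to\mathrm{End}(\mathtt{HD}^{\le m}(\mathfrak g;W))$, $v\mapsto v\lrcorner$, extends uniquely to a Lie algebra anti-morphism $\mathfrak g\to\mathrm{End}(\mathtt{HD}^{\le m}(\mathfrak g;W))$, i.e., to a linear map satisfying \[ [v,w]\lrcorner=-[v\lrcorner,w\lrcorner] \] for every $v,w\in\mathfrak g$. Furthermore, the map $v\mapsto v\lrcorner$ satisfies the following properties: (i) If $v\in V_\ell$ and $A\in\mathtt{HD}^{\le m}(\mathfrak g;W)$, then $(v\lrcorner A)^k=0$ for all $k>m-\ell$, and if $A=A^{\le m}_{f,p}$ for some $f\in C^\infty(G;W)$ and $p\in G$, then \[ (v\lrcorner A)^k=\left.\frac{d}{dt}\right|_{t=0}A^k_{f,p\exp(tv)}\qquad\text{for all } k\le m-\ell . \] (ii) If $v\in V_a$, $w\in V_b$, $A\in\mathtt{HD}^{\le m}(\mathfrak g;W)$, and $A=A^{\le m}_{f,p}$ for some $f\in C^\infty(G;W)$ and $p\in G$, then \[ \left.\frac{d}{dt}\right|_{t=0}A^k_{f,p\exp(t[v,w])}=\big(w\lrcorner(v\lrcorner A)-v\lrcorner(w\lrcorner A)\big)^k\qquad\text{for all } k\le m-a-b . \]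
   Context: $G$ is a stratified (Carnot) group of step $s\ge1$: a connected, simply connected Lie group with Lie algebra $\mathfrak g=V_1\oplus\dots\oplus V_s$, $V_s\neq\{0\}$, $[V_1,V_j]=V_{j+1}$ for $1\le j<s$, $[V_i,V_j]=0$ for $i+j>s$. The bracket of $\mathfrak g$ is that of left-invariant vector fields. $W$ is a finite-dimensional real vector space. For $v\in\mathfrak g$, $\tilde v$ is the left-invariant vector field on $G$ with $\tilde v(e)=v$. For $f\in C^\infty(G;W)$, $k\ge 0$ and $p\in G$, $A^k_{f,p}$ is the $k$-multilinear map $V_1^k\to W$, $A^k_{f,p}(v_1,\dots,v_k)=\tilde v_k\cdots\tilde v_1f(p)$ (with $A^0_{f,p}=f(p)$). $\mathtt{HD}^k(\mathfrak g;W)$ is the vector space of all such $k$-multilinear maps, $\mathtt{HD}^0(\mathfrak g;W)=W$, and $\mathtt{HD}^{\le m}(\mathfrak g;W)=\bigoplus_{k=0}^m\mathtt{HD}^k(\mathfrak g;W)$; the $k$-th component of $A\in \mathtt{HD}^{\le m}$ is denoted $A^k$, and $A^{\le m}_{f,p}=\sum_{k=0}^mA^k_{f,p}$. Right contraction by $v\in V_1$: for $A\in\mathtt{HD}^k(\mathfrak g;W)$, $k\ge1$, $v\lrcorner A\in\mathtt{HD}^{k-1}(\mathfrak g;W)$ is $(v\lrcorner A)(v_1,\dots,v_{k-1})=A(v_1,\dots,v_{k-1},v)$. On $\mathtt{HD}^{\le m}$: $(v\lrcorner A)^k=v\lrcorner A^{k+1}$ for $k<m$ and $(v\lrcorner A)^m=0$.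 On $\mathrm{End}(V)$, $[S,T]=ST-TS$. *)

(* Defs.v *)
From HB Require Import structures.
From mathcomp Require Import all_boot all_order all_algebra.
From mathcomp Require Import mathcomp_extra boolp classical_sets functions.
From mathcomp Require Import set_interval interval_inference reals topology.
From mathcomp Require Import normedtype landau derive.

Set Implicit Arguments.
Unset Strict Implicit.
Unset Printing Implicit Defensive.

Import Order.TTheory GRing.Theory Num.Theory.
Import numFieldNormedType.Exports.

Local Open Scope classical_set_scope.
Local Open Scope ring_scope.

Section Smooth.
Variables (R : realType) (E F : normedModType R).

Fixpoint Ck (k : nat) (O : set E) (f : E -> F) : Prop :=
  if k is k'.+1 then
    (forall x, O x -> differentiable f x) /\
    (forall v, Ck k' O (fun x => 'D_v f x))
  else forall x, O x -> {for x, continuous f}.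

Definition smooth_on (O : set E) (f : E -> F) : Prop := forall k, Ck k O f.

End Smooth.

Section SmoothTheory.
Context {R : realType} {E F : normedModType R}.
Implicit Types (f g : E -> F) (O P : set E).

Lemma near_eq_differentiable f g x :
  (\forall y \near x, f y = g y) -> differentiable f x -> differentiable g x.
Proof.
move=> fg df.
pose h := g - f.
have h0 : \forall y \near x, h y = 0.
  by apply: filterS fg => y fgy; rewrite /h -[LHS]/(g y - f y) fgy subrr.
have hx : h x = 0 by exact: nbhs_singleton h0.
have c0 : continuous (\0 : E -> F) by exact: cst_continuous.
have eh : h \o shift x = cst (h x) + (\0 : {linear E -> F}) +o_ (0 : E) id.
  apply/eqaddoP => _/posnumP[e].
  have : \forall y \near (0 : E), h (y + x) = 0.
    by move: h0; rewrite (near_shift 0)/=; rewrite subr0.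
  apply: filterS => y hy.
  rewrite -[X in `|X|]/(h (y + x) - (h x + 0)) hy hx addr0 subr0 normr0.
  by rewrite mulr_ge0.
have dh : differentiable h x.
  by apply/diff_locallyP; rewrite (diff_unique c0 eh).
by have -> : g = f + h; [rewrite /h addrC subrK|exact: differentiableD].
Qed.

Lemma Ck_ext k O f g : open O -> (forall x, O x -> f x = g x) ->
  Ck k O f -> Ck k O g.
Proof.
move=> oO; elim: k f g => [|k IH] f g fg /=.
  move=> cf x Ox; rewrite /prop_for /continuous_at -(fg x Ox).
  apply: cvg_trans (cf x Ox); apply: near_eq_cvg.
  by near=> y; apply: fg; near: y; exact: open_nbhs_nbhs.
have nfg x : O x -> \forall y \near x, f y = g y.
  by move=> Ox; near=> y; apply: fg; near: y; exact: open_nbhs_nbhs.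
move=> [df Df]; split=> [x Ox|v].
  exact: near_eq_differentiable (nfg x Ox) (df x Ox).
by apply: IH (Df v) => x Ox; apply: near_eq_derive; exact: nfg.
Unshelve. all: by end_near. Qed.

Lemma Ck_sub k O P f : P `<=` O -> Ck k O f -> Ck k P f.
Proof.
move=> PO; elim: k f => [|k IH] f /= => [cf x /PO|[df Df]]; first exact: cf.
by split=> [x /PO|v]; [exact: df|exact: IH].
Qed.

Lemma Ck_local k O f :
  (forall x, O x -> exists2 P, P x & Ck k P f) -> Ck k O f.
Proof.
elim: k f => [|k IH] f /= H.
  by move=> x /H[P Px cf]; exact: cf.
split=> [x /H[P Px [df _]]|v]; first exact: df.
by apply: IH => x /H[P Px [_ Df]]; exists P.
Qed.

Lemma CkW k O f : Ck k.+1 O f -> Ck k O f.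
Proof.
elim: k f => [|k IH] f [df Df] /=.
  by move=> x Ox; exact/differentiable_continuous/df.
by split=> // v; exact: IH.
Qed.

Lemma Ck_cst k O (a : F) : Ck k O (fun=> a).
Proof.
elim: k a => [|k IH] a /=; first by move=> x _; exact: cst_continuous.
split=> [x _|v]; first exact: differentiable_cst.
have -> : (fun x => 'D_v (fun=> a) x) = (fun=> 0) :> (E -> F).
  by apply/funext => x; exact: derive_cst.
exact: IH.
Qed.

Lemma CkD k O f g : open O -> Ck k O f -> Ck k O g -> Ck k O (fun x => f x + g x).
Proof.
move=> oO; elim: k f g => [|k IH] f g /=.
  by move=> cf cg x Ox; apply: cvgD; [exact: cf|exact: cg].
move=> [df Df] [dg Dg]; split=> [x Ox|v].
  by apply: differentiableD; [exact: df|exact: dg].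
apply: Ck_ext (IH _ _ (Df v) (Dg v)) => // x Ox; apply/esym.
by apply: deriveD; apply: diff_derivable; [exact: df|exact: dg].
Qed.

Lemma Ck_sum k O n (f : 'I_n -> E -> F) : open O ->
  (forall i, Ck k O (f i)) -> Ck k O (fun x => \sum_(i < n) f i x).
Proof.
move=> oO; elim: n f => [|n IH] f H.
  have -> : (fun x => \sum_(i < 0) f i x) = (fun=> 0) :> (E -> F).
    by apply/funext => x; rewrite big_ord0.
  exact: Ck_cst.
have -> : (fun x => \sum_(i < n.+1) f i x) = (fun x =>
    \sum_(i < n) f (widen_ord (leqnSn n) i) x + f ord_max x).
  by apply/funext => x; rewrite big_ord_recr.
by apply: CkD => //; exact: IH.
Qed.

End SmoothTheory.

Section SmoothComp.
Context {R : realType}.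

Lemma Ck_linear (E F F' : normedModType R) k (O : set E) (L : {linear F -> F'})
  (f : E -> F) : open O -> continuous L -> Ck k O f -> Ck k O (fun x => L (f x)).
Proof.
move=> oO cL; elim: k f => [|k IH] f /=.
  by move=> cf x Ox; apply: continuous_comp; [exact: cf|exact: cL].
have dL y : differentiable L y by exact: linear_differentiable.
move=> [df Df]; split=> [x Ox|v].
  by apply: (@differentiable_comp _ _ _ _ f L) => //; exact: df.
apply: Ck_ext (IH _ (Df v)) => // x Ox; have dfx := df x Ox.
rewrite [RHS]deriveE; last exact: (@differentiable_comp _ _ _ _ f L).
by rewrite (@diff_comp _ _ _ _ f L)//= diff_lin// deriveE.
Qed.

Lemma scale_is_bilinear (F : normedModType R) :
  bilinear_for
    (GRing.Scale.Law.clone _ _ *:%R _) (GRing.Scale.Law.clone _ _ *:%R _)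
    (@GRing.scale R F).
Proof.
split=> [u'|u] a x y /=; first by rewrite scalerDl scalerA.
by rewrite scalerDr !scalerA mulrC.
Qed.

Lemma is_diff_scale (E F : normedModType R) (r : E -> R) (f : E -> F) x :
  differentiable r x -> differentiable f x ->
  is_diff x (fun y => r y *: f y) (fun v => 'd r x v *: f x + r x *: 'd f x v).
Proof.
move=> dr df.
pose bM := bilinear_isBilinear.Build R R F F _ _ _ (scale_is_bilinear F).
pose b : {bilinear R -> F -> F} := HB.pack (@GRing.scale R F) bM.
have cb : continuous (fun p : R * F => b p.1 p.2) by move=> p; exact: scale_continuous.
have db p : differentiable (fun p : R * F => b p.1 p.2) p.
  exact: differentiable_bilin.
have drf : differentiable (fun y => (r y, f y)) x by exact: differentiable_pair.
apply: DiffDef.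
  exact: (@differentiable_comp _ _ _ _ (fun y => (r y, f y)) (fun p => b p.1 p.2)).
rewrite (@diff_comp _ _ _ _ (fun y => (r y, f y)) (fun p => b p.1 p.2))//.
rewrite diff_bilin// diff_pair//; apply/funext => v /=.
by rewrite addrC.
Qed.

Lemma CkZ (E F : normedModType R) k (O : set E) (r : E -> R) (f : E -> F) :
  open O -> Ck k O r -> Ck k O f -> Ck k O (fun x => r x *: f x).
Proof.
move=> oO; elim: k r f => [|k IH] r f.
  by move=> cr cf x Ox; apply: cvgZ; [exact: cr|exact: cf].
move=> Cr Cf; have [[dr Dr] [df Df]] := (Cr, Cf).
have dZ x Ox := is_diff_scale (dr x Ox) (df x Ox).
split=> [x /dZ[]//|v].
have C1 := IH _ _ (Dr v) (CkW Cf).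
have C2 := IH _ _ (CkW Cr) (Df v).
apply: Ck_ext (CkD oO C1 C2) => // x Ox; have d := dZ x Ox.
by rewrite [RHS]deriveE// diff_val !deriveE//; [exact: df|exact: dr].
Qed.

Lemma Ck_coord (E : normedModType R) n k (O : set E) (f : E -> 'rV[R]_n) i :
  open O -> Ck k O f -> Ck k O (fun x => f x 0 i).
Proof.
move=> oO Cf.
pose c (M : 'rV[R]_n) := M 0 i.
have lc : linear c by move=> a u v; rewrite /c !mxE.
pose cM := GRing.isLinear.Build _ _ _ _ _ lc.
pose cL : {linear 'rV[R]_n -> R} := HB.pack c cM.
have cc : continuous cL by exact: coord_continuous.
exact: (Ck_linear oO cc Cf).
Qed.

Lemma Ck_comp k (E F : normedModType R) n (O : set E) (P : set 'rV[R]_n)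
  (f : E -> 'rV[R]_n) (g : 'rV[R]_n -> F) :
  open O -> (forall x, O x -> P (f x)) -> Ck k O f -> Ck k P g ->
  Ck k O (g \o f).
Proof.
move=> oO fOP; elim: k g => [|k IH] g.
  move=> cf cg x Ox; apply: continuous_comp; first exact: cf.
  by apply: cg; exact: fOP.
move=> Cf [dg Dg']; have [df Df'] := Cf; split=> [x Ox|v].
  by apply: differentiable_comp; [exact: df|exact/dg/fOP].
have Df u : Ck k O (fun x => 'D_u f x) by exact: Df'.
have Dg u : Ck k P (fun x => 'D_u g x) by exact: Dg'.
have C : Ck k O (fun x => \sum_(i < n) 'D_v f x 0 i *: ('D_(delta_mx 0 i) g \o f) x).
  apply: Ck_sum => // i; apply: CkZ => //.
    exact: (Ck_coord i oO (Df v)).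
  exact: (IH _ (CkW Cf) (Dg _)).
apply: Ck_ext C => // x Ox.
have dfx := df x Ox; have dgx := dg _ (fOP x Ox).
rewrite [RHS]deriveE; last exact: differentiable_comp.
rewrite diff_comp//= -(deriveE v dfx) [X in 'd g _ X]row_sum_delta linear_sum/=.
by apply: eq_bigr => i _; rewrite linearZ/= (deriveE _ dgx).
Qed.

Lemma Ck_affine k (E E' F : normedModType R) (O : set E')
  (L : {linear E -> E'}) (b : E') (f : E' -> F) :
  continuous L -> Ck k O f -> Ck k [set x | O (L x + b)] (fun x => f (L x + b)).
Proof.
move=> cL; have dL x : differentiable (fun y => L y + b) x.
  by apply: (@differentiableD _ _ _ L (cst b)) => //; exact: linear_differentiable.
elim: k f => [|k IH] f /=.
  move=> cf x Ox; apply: (@continuous_comp _ _ _ (fun y => L y + b)); last exact: cf.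
  exact: differentiable_continuous.
move=> [df Df]; split=> [x Ox|v].
  by apply: (@differentiable_comp _ _ _ _ (fun y => L y + b)) => //; exact: df.
have -> : (fun x => 'D_v (fun x => f (L x + b)) x) = (fun x => 'D_(L v) f (L x + b)).
  apply/funext => x; rewrite /derive.
  set u := (X in lim (X @ _)); set w := (X in _ = lim (X @ _)).
  suff -> : u = w by [].
  apply/funext => h; rewrite /u /w /=.
  by have -> : L (h *: v + x) = h *: L v + L x; rewrite ?addrA// linearD linearZ.
exact: (IH _ (Df (L v))).
Qed.
End SmoothComp.


(* chart_to and chart_inv are total functions; only their values on chart_dom
   and on chart_cod are meaningful. *)
Record chart (R : realType) (n : nat) (M : topologicalType) := Chart {
  chart_dom : set M;
  chart_cod : set 'rV[R]_n;
  chart_to :> M -> 'rV[R]_n;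
  chart_inv : 'rV[R]_n -> M;
  chart_dom_open : open chart_dom;
  chart_cod_open : open chart_cod;
  chart_to_cod : forall p, chart_dom p -> chart_cod (chart_to p);
  chart_inv_dom : forall x, chart_cod x -> chart_dom (chart_inv x);
  chart_toK : forall p, chart_dom p -> chart_inv (chart_to p) = p;
  chart_invK : forall x, chart_cod x -> chart_to (chart_inv x) = x;
  chart_to_cont : forall p, chart_dom p -> {for p, continuous chart_to};
  chart_inv_cont : forall x, chart_cod x -> {for x, continuous chart_inv} }.

(* chart_at p is a preferred chart around p, as needed to read tangent vectors
   at p in coordinates. *)
HB.mixin Record isManifold (R : realType) (n : nat) M of Topological M := {
  charts : set (chart R n M);
  chart_at : M -> chart R n M;
  charts_chart_at : forall p : M, charts (chart_at p);
  chart_at_dom : forall p : M, chart_dom (chart_at p) p;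
  charts_compatible : forall c d : chart R n M, charts c -> charts d ->
    smooth_on (chart_cod c `&` chart_inv c @^-1` chart_dom d)
              (d \o chart_inv c);
  manifold_hausdorff : hausdorff_space M;
  manifold_second_countable : @second_countable M }.

#[short(type="manifoldType")]
HB.structure Definition Manifold (R : realType) (n : nat) :=
  {M of isManifold R n M & Topological M}.

HB.mixin Record isLieGroup (R : realType) (n : nat) G
    of Group G & Manifold R n G := {
  mulg_cont : continuous (fun pq : G * G => (pq.1 * pq.2)%g);
  mulg_smooth : forall c d e : chart R n G, charts c -> charts d -> charts e ->
    smooth_on [set xy : 'rV[R]_n * 'rV[R]_n |
                [/\ chart_cod c xy.1, chart_cod d xy.2 &
                    chart_dom e (chart_inv c xy.1 * chart_inv d xy.2)%g]]
              (fun xy => e (chart_inv c xy.1 * chart_inv d xy.2)%g);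
  invg_cont : continuous (fun p : G => (p^-1)%g);
  invg_smooth : forall c d : chart R n G, charts c -> charts d ->
    smooth_on [set x | chart_cod c x /\ chart_dom d (chart_inv c x)^-1%g]
              (fun x => d (chart_inv c x)^-1%g) }.

#[short(type="lieGroupType")]
HB.structure Definition LieGroup (R : realType) (n : nat) :=
  {G of isLieGroup R n G & Group G & Manifold R n G}.

Definition smooth (R : realType) (n : nat) (M : manifoldType R n)
    (U : normedModType R) (f : M -> U) : Prop :=
  forall c : chart R n M, charts c -> smooth_on (chart_cod c) (f \o chart_inv c).


Section LieGroup.
Variables (R : realType) (n : nat) (G : lieGroupType R n).

(* The Lie algebra T_1 G is 'rV[R]_n, a tangent vector at 1 being identified
   with its coordinates in the preferred chart at 1. lvf v f is the derivative
   of f along the left-invariant vector field whose value at 1 is v: at p it is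
   the differential at 1 of q |-> f (p * q), applied to v. *)
Definition lvf (U : normedModType R) (v : 'rV[R]_n) (f : G -> U) (p : G) : U :=
  'D_v (fun y => f (p * chart_inv (chart_at (1%g : G)) y)%g)
       (chart_at (1%g : G) 1%g).

(* This determines br: a left-invariant vector field is determined by its action
   on the smooth functions, and by its value at 1. *)
Definition is_lie_bracket (br : 'rV[R]_n -> 'rV[R]_n -> 'rV[R]_n) : Prop :=
  forall v w (f : G -> R), smooth f -> forall p,
    lvf (br v w) f p = lvf v (lvf w f) p - lvf w (lvf v f) p.

Definition smooth_curve (gamma : R -> G) : Prop :=
  continuous gamma /\
  forall c : chart R n G, charts c ->
    smooth_on (gamma @^-1` chart_dom c) (c \o gamma).

(* t |-> E (t *: v) is the one-parameter subgroup with velocity v at t = 0. *)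
Definition is_lie_exp (E : 'rV[R]_n -> G) : Prop :=
  forall v, [/\ forall a b : R, E ((a + b) *: v) = (E (a *: v) * E (b *: v))%g,
                smooth_curve (fun t => E (t *: v)) &
                is_derive (0 : R) 1 (fun t => chart_at (1%g : G) (E (t *: v))) v].

(* Every loop is null-homotopic; connectedness is required separately. *)
Definition simply_connected (T : topologicalType) : Prop :=
  forall gamma : R -> T, {within `[0, 1], continuous gamma} ->
  gamma 0 = gamma 1 ->
  exists H : R * R -> T,
    [/\ {within `[0, 1] `*` `[0, 1], continuous H},
        forall x, x \in `[0, 1] -> H (x, 0) = gamma x,
        forall x, x \in `[0, 1] -> H (x, 1) = gamma 0 &
        forall t, t \in `[0, 1] -> H (0, t) = gamma 0 /\ H (1, t) = gamma 0].

(* T = [U, V], the least subspace that contains all brackets. *)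
Definition is_bracket_space (br : 'rV[R]_n -> 'rV[R]_n -> 'rV[R]_n)
    (U V T : {vspace 'rV[R]_n}) : Prop :=
  forall X : {vspace 'rV[R]_n},
    (T <= X)%VS <-> (forall u v, u \in U -> v \in V -> br u v \in X).

(* The layers are V 1, ..., V s; the other values of V are irrelevant. *)
Record stratified (br : 'rV[R]_n -> 'rV[R]_n -> 'rV[R]_n) (s : nat)
    (V : nat -> {vspace 'rV[R]_n}) : Prop := Stratified {
  stratified_connected : connected [set: G];
  stratified_simply_connected : simply_connected G;
  stratified_step : (0 < s)%N;
  stratified_direct : directv (\sum_(j < s) V j.+1);
  stratified_full : (\sum_(j < s) V j.+1)%VS = fullv;
  stratified_last : V s != 0%VS;
  stratified_generate : forall j, (1 <= j < s)%N ->
    is_bracket_space br (V 1%N) (V j) (V j.+1);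
  stratified_nilpotent : forall i j, (1 <= i <= s)%N -> (1 <= j <= s)%N ->
    (s < i + j)%N -> forall u v, u \in V i -> v \in V j -> br u v = 0 }.

End LieGroup.

Lemma continuous_pair0l (R : realType) (E F : normedModType R) :
  continuous (fun y : F => (0 : E, y)).
Proof.
move=> y; have h1 : (0 : E) @[z --> y] --> (0 : E) by exact: cvg_cst.
have h2 : z @[z --> y] --> y by exact: cvg_id.
exact: (cvg_pair h1 h2).
Qed.

Lemma continuous_pair0r (R : realType) (E F : normedModType R) :
  continuous (fun x : E => (x, 0 : F)).
Proof.
move=> x; have h1 : z @[z --> x] --> x by exact: cvg_id.
have h2 : (0 : F) @[z --> x] --> (0 : F) by exact: cvg_cst.
exact: (cvg_pair h1 h2).
Qed.

Section LieGroupTheory.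
Context {R : realType} {n : nat} {G : lieGroupType R n} {U : normedModType R}.
Implicit Types f g : G -> U.

Let open_cod2 (c d : chart R n G) :
  open [set xy : 'rV[R]_n * 'rV[R]_n | chart_cod c xy.1 /\ chart_cod d xy.2].
Proof.
have o1 : open (fst @^-1` chart_cod c : set ('rV[R]_n * 'rV[R]_n)).
  have := @open_comp ('rV[R]_n * 'rV[R]_n)%type 'rV[R]_n fst (chart_cod c).
  by apply; [move=> x _; exact: cvg_fst|exact: chart_cod_open].
have o2 : open (snd @^-1` chart_cod d : set ('rV[R]_n * 'rV[R]_n)).
  have := @open_comp ('rV[R]_n * 'rV[R]_n)%type 'rV[R]_n snd (chart_cod d).
  by apply; [move=> x _; exact: cvg_snd|exact: chart_cod_open].
exact: openI o1 o2.
Qed.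

Lemma smooth_mul f (c d : chart R n G) : charts c -> charts d -> smooth f ->
  smooth_on [set xy : 'rV[R]_n * 'rV[R]_n | chart_cod c xy.1 /\ chart_cod d xy.2]
    (fun xy => f (chart_inv c xy.1 * chart_inv d xy.2)%g).
Proof.
move=> hc hd sf k; apply: Ck_local => -[x0 y0] /= [cx0 dy0].
pose e : chart R n G := chart_at (chart_inv c x0 * chart_inv d y0)%g.
have he : charts e by exact: charts_chart_at.
pose P := [set xy : 'rV[R]_n * 'rV[R]_n |
  [/\ chart_cod c xy.1, chart_cod d xy.2 &
      chart_dom e (chart_inv c xy.1 * chart_inv d xy.2)%g]].
have oP : open P.
  rewrite openE => -[x y] [/= cx dy exy]; rewrite /interior.
  have nQ : nbhs (x, y) [set xy : 'rV[R]_n * 'rV[R]_n |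
      chart_cod c xy.1 /\ chart_cod d xy.2].
    by apply: open_nbhs_nbhs; split => //; exact: open_cod2.
  have cm : {for (x, y), continuous (fun xy : 'rV[R]_n * 'rV[R]_n =>
      (chart_inv c xy.1 * chart_inv d xy.2)%g)}.
    have c1 : chart_inv c z.1 @[z --> (x, y)] --> chart_inv c x.
      apply: (@cvg_comp _ _ _ fst (chart_inv c)); first exact: cvg_fst.
      exact: chart_inv_cont.
    have c2 : chart_inv d z.2 @[z --> (x, y)] --> chart_inv d y.
      apply: (@cvg_comp _ _ _ snd (chart_inv d)); first exact: cvg_snd.
      exact: chart_inv_cont.
    exact: (cvg_comp _ _ (cvg_pair c1 c2) (mulg_cont (chart_inv c x, chart_inv d y))).
  have := cm (chart_dom e) (open_nbhs_nbhs (conj (chart_dom_open e) exy)).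
  by apply: filterS2 nQ => -[a b] /= [? ?] ?; split.
exists P; first by split => //=; exact: chart_at_dom.
have Cm : Ck k P (fun xy => e (chart_inv c xy.1 * chart_inv d xy.2)%g).
  exact: mulg_smooth.
apply: Ck_ext oP _ (Ck_comp oP _ Cm (sf e he k)).
  by move=> -[x y] [/= _ _ exy]; rewrite chart_toK.
by move=> -[x y] [/= _ _ exy]; exact: chart_to_cod.
Qed.

Lemma smooth_mul_l f (q : G) (d : chart R n G) : charts d -> smooth f ->
  smooth_on (chart_cod d) (fun y => f (q * chart_inv d y)%g).
Proof.
move=> hd sf k; pose c : chart R n G := chart_at q.
have hc : charts c by exact: charts_chart_at.
have cq : chart_dom c q by exact: chart_at_dom.
pose i (y : 'rV[R]_n) : 'rV[R]_n * 'rV[R]_n := (0, y).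
have li : linear i.
  by move=> a u v; rewrite /i; congr (_, _) => /=; rewrite scaler0 addr0.
pose iM := GRing.isLinear.Build _ _ _ _ _ li.
pose L : {linear 'rV[R]_n -> ('rV[R]_n * 'rV[R]_n)%type} := HB.pack i iM.
have cL : continuous L.
  exact: continuous_pair0l.
have := Ck_affine (c q, 0) cL (smooth_mul hc hd sf k).
rewrite /= /i /= => Ci.
have Cd : Ck k (chart_cod d)
    (fun y => f (chart_inv c (0 + c q) * chart_inv d (y + 0))%g).
  by apply: Ck_sub Ci => y dy /=; rewrite add0r addr0; split => //; exact: chart_to_cod.
apply: Ck_ext Cd; first exact: chart_cod_open.
by move=> y _; rewrite add0r addr0 chart_toK.
Qed.

Lemma smooth_lmul f (q : G) : smooth f -> smooth (fun p => f (q * p)%g).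
Proof. by move=> sf c hc; exact: smooth_mul_l. Qed.

Let chart1_cod : chart_cod (chart_at (1%g : G)) (chart_at (1%g : G) 1%g).
Proof. by apply: chart_to_cod; exact: chart_at_dom. Qed.

Lemma derivable_lvf f (p : G) v : smooth f ->
  derivable (fun y => f (p * chart_inv (chart_at (1%g : G)) y)%g)
            (chart_at (1%g : G) 1%g) v.
Proof.
move=> sf; apply: diff_derivable.
have [df _] := smooth_mul_l p (charts_chart_at (1%g : G)) sf 1%N.
exact: df.
Qed.

Lemma smooth_lvf v f : smooth f -> smooth (lvf v f).
Proof.
move=> sf c hc k; pose d : chart R n G := chart_at (1%g : G).
have hd : charts d by exact: charts_chart_at.
pose h (xy : 'rV[R]_n * 'rV[R]_n) := f (chart_inv c xy.1 * chart_inv d xy.2)%g.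
have [_ /(_ (0, v)) Dh] := smooth_mul hc hd sf k.+1.
pose i (x : 'rV[R]_n) : 'rV[R]_n * 'rV[R]_n := (x, 0).
have li : linear i.
  by move=> a u w; rewrite /i; congr (_, _) => /=; rewrite scaler0 addr0.
pose iM := GRing.isLinear.Build _ _ _ _ _ li.
pose L : {linear 'rV[R]_n -> ('rV[R]_n * 'rV[R]_n)%type} := HB.pack i iM.
have cL : continuous L.
  exact: continuous_pair0r.
have := Ck_affine (0, d 1%g) cL Dh; rewrite -/(h) => Ci.
have Cd : Ck k (chart_cod c) (fun x => 'D_(0, v) h (L x + (0, d 1%g))).
  by apply: Ck_sub Ci => x cx /=; rewrite addr0 add0r; split.
apply: Ck_ext Cd; first exact: chart_cod_open.
move=> x cx; rewrite /lvf /= /derive.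
set u := (X in lim (X @ _)); set w := (X in _ = lim (X @ _)).
suff -> : u = w by [].
apply/funext => t; rewrite /u /w /h /= /i /= scaler0 !addr0 !add0r.
by [].
Qed.

Lemma smooth_comb (a : R) f g : smooth f -> smooth g -> smooth (a *: f + g).
Proof.
move=> sf sg c hc k; have oc := @chart_cod_open _ _ _ c.
exact: CkD oc (CkZ oc (Ck_cst _ _ a) (sf c hc k)) (sg c hc k).
Qed.

Lemma lvf_comb (a : R) v f g : smooth f -> smooth g ->
  lvf v (a *: f + g) = a *: lvf v f + lvf v g.
Proof.
move=> sf sg; apply/funext => p.
have df := derivable_lvf (p := p) (v := v) sf; have dg := derivable_lvf (p := p) (v := v) sg.
rewrite -[RHS]/(a *: lvf v f p + lvf v g p) /lvf -deriveZ// -deriveD//.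
exact: derivableZ.
Qed.

End LieGroupTheory.

Section HD.
Variables (R : realType) (n : nat) (G : lieGroupType R n).
Variables (V1 : {vspace 'rV[R]_n}) (U : normedModType R).
Implicit Types (f g : G -> U) (p q : G) (w : seq (subvs_of V1)).

(* On a word w = [:: v_1; ...; v_k], applies v_1 first and v_k last. *)
Definition hder_word f p w : U := foldl (fun h v => lvf (vsval v) h) f w p.

Definition hder f p k : k.-tuple (subvs_of V1) -> U := fun t => hder_word f p t.

Arguments hder f p k t : clear implicits.

Definition HD k : set (k.-tuple (subvs_of V1) -> U) :=
  [set A | exists f p, smooth f /\ A = hder f p k].

Definition component (A : seq (subvs_of V1) -> U) k :
    k.-tuple (subvs_of V1) -> U := fun t => A t.

Arguments component A k t : clear implicits.

(* The direct sum of HD 0, ..., HD m. A family (A^k)_k of maps V1^k -> U is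
   encoded as a single function on the words in V1, whose restriction to the
   words of length k is A^k. *)
Definition HDle_pred m : {pred seq (subvs_of V1) -> U} :=
  mem [set A : seq (subvs_of V1) -> U |
    (forall k, (k <= m)%N -> HD (component A k)) /\
    (forall k, (m < k)%N -> component A k = fun=> 0)].

Lemma foldl_lvf_comb (a : R) w f g : smooth f -> smooth g ->
  foldl (fun h v => lvf (vsval v) h) (a *: f + g) w =
  a *: foldl (fun h v => lvf (vsval v) h) f w +
  foldl (fun h v => lvf (vsval v) h) g w.
Proof.
elim: w f g => [|v w IH] f g sf sg //=.
by rewrite lvf_comb// IH//; exact: smooth_lvf.
Qed.

Lemma hder_word_comb (a : R) f g p w : smooth f -> smooth g ->
  hder_word (a *: f + g) p w = a *: hder_word f p w + hder_word g p w.
Proof. by move=> sf sg; rewrite /hder_word foldl_lvf_comb. Qed.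

Lemma hder_word_lmul q f p w :
  hder_word (fun x => f (q * x)%g) p w = hder_word f (q * p)%g w.
Proof.
rewrite /hder_word; elim: w f => [|v w IH] f //=; rewrite -IH.
suff -> : lvf (vsval v) (fun x => f (q * x)%g) =
          (fun x => lvf (vsval v) f (q * x)%g) by [].
apply/funext => x; rewrite /lvf; congr ('D__ _ _).
by apply/funext => y; rewrite mulgA.
Qed.

Lemma smooth_cst (a : U) : smooth (fun _ : G => a).
Proof. by move=> c hc k; exact: Ck_cst. Qed.

Lemma HDle_submod_closed m : submod_closed (HDle_pred m).
Proof.
split=> [|a A B]; rewrite !inE /=.
  split=> // k _; exists (fun=> 0), 1%g; split; first exact: smooth_cst.
  apply/funext => t; rewrite /component /hder /hder_word.
  elim: {t}(tval t) => [|v t IH] //=.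
  suff -> : lvf (vsval v) (fun _ : G => 0 : U) = fun=> 0 by [].
  by apply/funext => x; rewrite /lvf; exact: derive_cst.
move=> [HA A0] [HB B0]; split=> k km; last first.
  apply/funext => t; have := congr1 (fun h => h t) (A0 k km).
  have := congr1 (fun h => h t) (B0 k km); rewrite /component /= => Bt At.
  by rewrite -[LHS]/(a *: A t + B t) At Bt scaler0 addr0.
have [f [p [sf Ef]]] := HA k km; have [g [q [sg Eg]]] := HB k km.
exists (a *: (fun x => f (p * x)%g) + (fun x => g (q * x)%g)), 1%g.
split; first by apply: smooth_comb; exact: smooth_lmul.
apply/funext => t; have := congr1 (fun h => h t) Ef.
have := congr1 (fun h => h t) Eg; rewrite /component /hder => Bt At.
rewrite hder_word_comb; [|exact: smooth_lmul|exact: smooth_lmul].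
by rewrite !hder_word_lmul !mulg1 -At -Bt.
Qed.

HB.instance Definition _ m :=
  GRing.isSubmodClosed.Build R (seq (subvs_of V1) -> U) (HDle_pred m)
    (HDle_submod_closed m).

Record HDle m := MkHDle {
  HDle_val : seq (subvs_of V1) -> U;
  HDle_valP : HDle_val \in HDle_pred m }.

HB.instance Definition _ m := [isSub for @HDle_val m].
HB.instance Definition _ m := [Choice of HDle m by <:].
HB.instance Definition _ m := [SubChoice_isSubLmodule of HDle m by <:].

Definition HDcomp m (A : HDle m) k : k.-tuple (subvs_of V1) -> U :=
  component (HDle_val A) k.

Arguments HDcomp m A k t : clear implicits.

Definition is_jet m (A : HDle m) f p : Prop :=
  forall k, (k <= m)%N -> HDcomp m A k = hder f p k.

Definition rcontract k (v : subvs_of V1) (B : k.+1.-tuple (subvs_of V1) -> U) :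
    k.-tuple (subvs_of V1) -> U := fun t => B [tuple of rcons t v].

(* Phi v is the extended operator of right contraction by v. *)
Definition is_contraction_extension (br : 'rV[R]_n -> 'rV[R]_n -> 'rV[R]_n) m
    (Phi : 'rV[R]_n -> {linear HDle m -> HDle m}) : Prop :=
  [/\ forall (a : R) (v w : 'rV[R]_n) A,
        Phi (a *: v + w) A = a *: Phi v A + Phi w A,
      forall (v : subvs_of V1) A,
        (forall k, (k < m)%N ->
           HDcomp m (Phi (vsval v) A) k = rcontract v (HDcomp m A k.+1)) /\
        HDcomp m (Phi (vsval v) A) m = (fun=> 0) &
      forall (v w : 'rV[R]_n) A, Phi (br v w) A = - (Phi v (Phi w A) - Phi w (Phi v A))].

End HD.

Arguments HDle {R n} G V1 U m.
Arguments hder {R n G V1 U} f p k t.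
Arguments HDcomp {R n G V1 U m} A k t.


(* W with the topology of the supremum norm of the coordinates in a basis; all
   norms on W being equivalent, smoothness and derivatives of W-valued functions
   do not depend on this choice. *)
Definition fdnormed (R : realType) (W : vectType R) : Type := W.

Section FdNormed.
Variables (R : realType) (W : vectType R).

HB.instance Definition _ := Vector.on (fdnormed W).

Definition fdcoord (x : fdnormed W) : 'rV[R]_(\dim (fullv : {vspace W})) :=
  \row_i coord (vbasis (fullv : {vspace W})) i x.

Lemma fdcoord_linear : linear fdcoord.
Proof. by move=> a x y; apply/rowP => i; rewrite !mxE linearP. Qed.

HB.instance Definition _ :=
  GRing.isLinear.Build R (fdnormed W) _ _ fdcoord fdcoord_linear.

Let norm (x : fdnormed W) : R := `|fdcoord x|.

Let norm_triangle x y : norm (x + y) <= norm x + norm y.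
Proof. by rewrite /norm linearD; exact: ler_normD. Qed.

Let norm_scale (l : R) x : norm (l *: x) = `|l| * norm x.
Proof. by rewrite /norm linearZ; exact: normrZ. Qed.

Let norm_eq0 x : norm x = 0 -> x = 0.
Proof.
move=> /normr0_eq0 x0; rewrite (coord_vbasis (memvf (x : W))).
rewrite big1// => i _.
by have /rowP/(_ i) := x0; rewrite !mxE => ->; rewrite scale0r.
Qed.

HB.instance Definition _ :=
  Lmodule_isNormed.Build R (fdnormed W) norm_triangle norm_scale norm_eq0.

End FdNormed.

(* Main.v *)
(* Iterating the identity for brackets, the left-invariant field of v in V_l is
   a combination of words of length l in V_1, so that v _| A, evaluated at a word
   x, can be defined as the same combination of the values A (x u). If A is the
   jet of f at p in degree |x| + l, this value is the derivative along v of the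
   x-derivative of f, at p; hence it does not depend on the choice of the
   combination, and all the identities reduce to identities between left-invariant
   derivatives. That v _| A is again a family of jets holds since HD is finite
   dimensional, hence closed, and v _| A is a limit of difference quotients of
   jets. To get the bracket identity for nonhomogeneous elements, br must be
   bilinear, satisfy Jacobi and respect the grading; this holds because bump
   functions show that a left-invariant field is determined by its action on the
   smooth functions. *)
Require Import Defs.
From HB Require Import structures.
From mathcomp Require Import all_boot all_order all_algebra.
From mathcomp Require Import mathcomp_extra boolp classical_sets functions.
From mathcomp Require Import set_interval interval_inference reals topology.
From mathcomp Require Import normedtype landau derive.
From mathcomp Require Import sequences realfun exp.
From mathcomp Require Import ring.

Set Implicit Arguments.
Unset Strict Implicit.
Unset Printing Implicit Defensive.

Import Order.TTheory GRing.Theory Num.Theory.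
Import numFieldNormedType.Exports.

Local Open Scope classical_set_scope.
Local Open Scope ring_scope.

(** * Subspaces of finite-dimensional spaces and pointwise limits *)

Lemma linear_fun0 (K : pzRingType) (U U' : lmodType K) (f : U -> U') :
  linear f -> f 0 = 0.
Proof.
move=> lf; have := lf 1 0 0; rewrite scaler0 addr0 scale1r => /eqP.
by rewrite -subr_eq subrr eq_sym => /eqP.
Qed.

(** Turns a linear condition into a [{vspace}], so that the minimality of a bracket space can serve
    as an induction principle. Missing vectors of [P] are adjoined one at a time; the dimension
    bounds their number. *)
Lemma ex_vspace (K : fieldType) (T : vectType K) (P : T -> Prop) :
  P 0 -> (forall a u v, P u -> P v -> P (a *: u + v)) ->
  exists X : {vspace T}, forall v, v \in X <-> P v.
Proof.
move=> P0 PD.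
have PZ a u : P u -> P (a *: u) by move=> Pu; rewrite -[a *: u]addr0; exact: PD.
suff H k (X : {vspace T}) : (\dim {:T} - \dim X <= k)%N ->
    (forall v, v \in X -> P v) -> exists X : {vspace T}, forall v, v \in X <-> P v.
  by apply: (H (\dim {:T}) 0%VS); [exact: leq_subr|move=> v; rewrite memv0 => /eqP->].
elim: k X => [|k IH] X dX XP.
  exists X => v; split=> [/XP//|_].
  have /eqP -> : X == fullv by rewrite eqEdim subvf/= -subn_eq0 -leqn0.
  exact: memvf.
have [[v [Pv vX]]|nX] := pselect (exists v, P v /\ v \notin X); last first.
  exists X => v; split=> [/XP//|Pv].
  by apply/negP => /negP vX; apply: nX; exists v.
apply: (IH (X + <[v]>)%VS).
  have : (\dim X < \dim (X + <[v]>)%VS)%N.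
    have := dimv_leqif_eq (addvSl X <[v]>).
    move=> [le eq]; rewrite ltn_neqAle le andbT eq.
    apply: contra vX => /eqP ->.
    by rewrite (subvP (addvSr _ _))// memv_line.
  by move: dX; rewrite !leq_subLR addnS -addSn => dX lt; apply: leq_trans dX _; rewrite leq_add2r.
move=> w /memv_addP[x xX [y /vlineP[a ->] ->]].
by rewrite addrC; apply: PD => //; exact: XP.
Qed.

(* Separating evaluations are removed one at a time: if [e0] does not vanish on
   [S], subtracting multiples of an element on which it is 1 reduces to its
   kernel in [S]. *)
Lemma pointwise_closed (R : realType) (T : Type) (U : normedModType R)
    (I : eqType) (L : I -> U -> R) (t : I -> T) (S : set (T -> U)) :
  (forall i, linear (L i)) -> (forall i, continuous (L i)) ->
  S 0 -> (forall a A B, S A -> S B -> S (a *: A + B)) ->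
  forall s : seq I, (forall A, S A -> (forall i, i \in s -> L i (A (t i)) = 0) -> A = 0) ->
  forall (X : Type) (F : set_system X), ProperFilter F ->
  forall (A : X -> T -> U) (B : T -> U), (forall h, S (A h)) ->
    (forall x, A h x @[h --> F] --> B x) -> S B.
Proof.
move=> linL cL S0 SD s; elim: s S S0 SD => [|i s IH] S S0 SD sep X F FF A B SA AB.
  have E0 C : S C -> C = 0 by move=> SC; exact: sep.
  suff -> : B = 0 by [].
  apply/funext => x.
  have c0 : A h x @[h --> F] --> (0 : U).
    have -> : (fun h => A h x) = fun=> 0 by apply/funext => h; rewrite (E0 _ (SA h)).
    exact: cvg_cst.
  exact: (cvg_unique (@norm_hausdorff _ U) (AB x) c0).
have LD a u v : L i (a *: u + v) = a * L i u + L i v by exact: linL.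
have L0 : L i 0 = 0 by exact: linear_fun0 (linL i).
have [[A0 [SA0 LA0]]|no] := pselect (exists A0, S A0 /\ L i (A0 (t i)) <> 0); last first.
  apply: (IH S _ _ _ X F FF A B) => // C SC C0; apply: sep => // j.
  rewrite inE => /predU1P[->|/C0//].
  by apply: contrapT => LC; apply: no; exists C.
have [A1 SA1 LA1] : exists2 A1, S A1 & L i (A1 (t i)) = 1.
  exists ((L i (A0 (t i)))^-1 *: A0 + 0); first exact: SD.
  rewrite -[X in L i X]/(_ *: A0 (t i) + 0) LD L0 addr0 mulVf//.
  exact/eqP.
pose S' : set (T -> U) := [set A | S A /\ L i (A (t i)) = 0].
pose c (A : T -> U) := L i (A (t i)).
pose C h := - c (A h) *: A1 + A h.
have [SB _] : S' (- c B *: A1 + B).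
  apply: (IH S' _ _ _ X F FF C) => //.
  - move=> a C1 C2 [S1 e1] [S2 e2]; split; first exact: SD.
    by rewrite -[X in L i X]/(a *: C1 (t i) + C2 (t i)) LD e1 e2 mulr0 addr0.
  - move=> D [SD' e] D0; apply: sep => // j.
    by rewrite inE => /predU1P[->|/D0].
  - move=> h; split; first exact: SD.
    rewrite -[X in L i X]/(- c (A h) *: A1 (t i) + A h (t i)) LD LA1 mulr1.
    by rewrite addrC subrr.
  - move=> x.
    apply: (@cvgD _ _ _ _ _ (fun h => - c (A h) *: A1 x) (fun h => A h x)) => //.
    apply: cvgZr_tmp; apply: cvgN.
    by apply: (@cvg_comp _ _ _ (fun h => A h (t i)) (L i)); [exact: AB|exact: cL].
(* The limit is its projection to the kernel plus the multiple of [A1] that was removed. *)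
have -> : B = c B *: A1 + (- c B *: A1 + B) by rewrite addrA -scalerDl subrr scale0r add0r.
exact: SD.
Qed.

(** * Bump functions *)

Section Bump.
Variable R : realType.
Implicit Types (x y h : R) (j k : nat).

(* [expinv 0] is the classical flat function; its derivatives are combinations
   of the [expinv j]. *)
Definition expinv j x : R := if 0 < x then x ^- j * expR (- x^-1) else 0.

(** The exponential series bounds [expR x^-1] below by its term of degree [j.+1], one degree more
    than [x ^- j]; the extra degree gives the factor [x]. *)
Lemma expinv_le j x : `|expinv j x| <= j.+1`!%:R * `|x|.
Proof.
rewrite /expinv; case: ifPn => [x0|_]; last by rewrite normr0 mulr_ge0.
have e0 : 0 < expR x^-1 by exact: expR_gt0.
rewrite expRN -invfM ger0_norm; last by rewrite invr_ge0 mulr_ge0 ?exprn_ge0 ?ltW.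
rewrite (gtr0_norm x0) invf_ple ?posrE; last 2 first.
- by rewrite mulr_gt0 ?exprn_gt0.
- by rewrite mulr_gt0 ?ltr0n ?fact_gt0.
have := expR_ge1Dxn j (ltW (_ : 0 < x^-1)); rewrite invr_gt0 => /(_ x0) le.
have {}le : x^-1 ^+ j.+1 / j.+1`!%:R <= expR x^-1 by apply: le_trans le; rewrite ler_wpDl.
have xj : 0 < x ^+ j by rewrite exprn_gt0.
rewrite -ler_pdivrMl//; apply: le_trans le.
by rewrite exprVn exprS !invfM mulrCA [leRHS]mulrC (mulrC x^-1).
Qed.

Lemma expinv_cvg0 j : expinv j h @[h --> (0 : R)] --> (0 : R).
Proof.
apply/cvgr0Pnorm_le => e e0.
have C0 : 0 < j.+1`!%:R :> R by rewrite ltr0n fact_gt0.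
apply: filterS (@nbhs0_le R R _ (divr_gt0 e0 C0)) => h he.
by apply: le_trans (expinv_le j h) _; rewrite mulrC -ler_pdivlMr.
Qed.

Lemma is_derive_expinv j x :
  is_derive x 1 (expinv j) (expinv j.+2 x - j%:R * expinv j.+1 x).
Proof.
have [x0|x0|->] := ltgtP x 0.
- apply: (@near_eq_is_derive _ _ _ (fun=> 0)); last first.
    by rewrite /expinv ltNge (ltW x0)/= mulr0 subr0; exact: is_derive_cst.
  near=> y; rewrite /expinv ltNge (_ : y <= 0)//.
  by apply/ltW; near: y; exact: lt_nbhsl.
- apply: (@near_eq_is_derive _ _ _ (fun y : R => y^-1 ^+ j * expR (- y^-1))).
    near=> y; rewrite /expinv exprVn (_ : 0 < y)//; near: y; exact: lt_nbhsr.
  have xn0 : x != 0 by rewrite gt_eqF.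
  have dV : is_derive x 1 (fun y : R => y^-1) (- x ^- 2).
    apply: DeriveDef; first by apply: derivableV.
    by rewrite deriveV// derive_id [_ *: _]mulr1.
  have dX : is_derive x 1 (fun y : R => y^-1 ^+ j) (j%:R * x^-1 ^+ j.-1 * (- x ^- 2)).
    have -> : (fun y : R => y^-1 ^+ j) = (fun y => y^-1) ^+ j.
      by apply/funext => y; rewrite exprfctE.
    exact: is_deriveX.
  have dE : is_derive x 1 (fun y : R => expR (- y^-1)) (expR (- x^-1) * x ^- 2).
    have dN : is_derive x 1 (fun y : R => - y^-1) (x ^- 2).
      by have := is_deriveN dV; rewrite opprK.
    have := @is_derive1_comp _ expR (fun y : R => - y^-1) x _ _ (is_derive_expR _) dN.
    by rewrite mulrC.
  have := is_deriveM dX dE => /is_derive_eq; apply.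
  rewrite /expinv x0 /GRing.scale/= -!exprVn.
  set z := x^-1; set e := expR _; clearbody e; clearbody z.
  case: j {dX} => [|j] /=; first by rewrite !expr0; ring.
  by rewrite !exprS; ring.
- have E0 i : expinv i 0 = 0 by rewrite /expinv ltxx.
  rewrite !E0 mulr0 subr0.
  (* At 0 the difference quotient of [expinv j] is [expinv j.+1]. *)
  have c : (fun h : R => h^-1 *: (expinv j (h *: 1 + 0) - expinv j 0)) @ 0^' --> (0 : R).
    have c1 : expinv j.+1 h @[h --> (0 : R)^'] --> (0 : R).
      by apply: cvg_trans (@expinv_cvg0 j.+1); apply: cvg_app; exact: cvg_within.
    apply: cvg_trans c1; apply: near_eq_cvg; near=> h.
    rewrite E0 subr0 addr0 [h *: 1]mulr1 /expinv; case: ifP => _; last by rewrite scaler0.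
    by rewrite -[_ *: _]/(_ * _) mulrA exprS invfM.
  apply: DeriveDef; first by apply/cvg_ex; exists 0.
  exact: cvg_lim c.
Unshelve. all: by end_near. Qed.

(** The induction is for all [j] at once, since a derivative involves [expinv j.+1] and
    [expinv j.+2]. *)
Lemma Ck_expinv k (E : normedModType R) (O : set E) (r : E -> R) j :
  open O -> Ck k O r -> Ck k O (fun p => expinv j (r p)).
Proof.
move=> oO; have dE i y : differentiable (expinv i) y.
  by apply/derivable1_diffP; have [] := is_derive_expinv i y.
elim: k r j => [|k IH] r j Cr.
  move=> x Ox; apply: (@continuous_comp _ _ _ r (expinv j)); first exact: Cr.
  exact: differentiable_continuous.
have [dr Dr] := Cr; split=> [x Ox|v].
  by apply: (@differentiable_comp _ _ _ _ r (expinv j)); [exact: dr|exact: dE].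
have C1 := IH r j.+2 (CkW Cr); have C2 := CkZ oO (Ck_cst k O (- j%:R : R)) (IH r j.+1 (CkW Cr)).
apply: Ck_ext (CkZ oO (Dr v) (CkD oO C1 C2)) => // x Ox.
have dx := dr x Ox.
rewrite [RHS]deriveE; last exact: (@differentiable_comp _ _ _ _ r (expinv j)).
rewrite (@diff_comp _ _ _ _ r (expinv j))//= -(deriveE v dx).
rewrite -[X in 'd _ _ X]mulr1 -[X in 'd _ _ X]/(_ *: 1) linearZ/= -deriveE//.
have [_ ->] := is_derive_expinv j (r x).
by rewrite scaleNr.
Qed.

End Bump.

(** * Extension by zero from a chart, and separation of tangent vectors by functions *)

Lemma open_chart_inv_preimage (R : realType) (n : nat) (M : topologicalType)
    (c : chart R n M) (A : set M) :
  open A -> open (chart_cod c `&` chart_inv c @^-1` A).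
Proof.
move=> oA; rewrite openE => x [cx Ax]; rewrite /interior.
apply: filterI; first by apply: open_nbhs_nbhs; split=> //; exact: chart_cod_open.
by apply: (chart_inv_cont cx); apply: open_nbhs_nbhs.
Qed.

(** On the chart domain a transition map reduces to [F]. Elsewhere the function is 0 near each
    point, because the image of [K] in [M] is compact, hence closed in a Hausdorff space. *)
Lemma smooth_extend0 (R : realType) (n : nat) (M : manifoldType R n)
    (U : normedModType R) (d : chart R n M) (K : set 'rV[R]_n) (F : 'rV[R]_n -> U) :
  charts d -> compact K -> K `<=` chart_cod d -> smooth_on (chart_cod d) F ->
  (forall y, ~ K y -> F y = 0) ->
  smooth (fun p => if `[< chart_dom d p >] then F (d p) else 0).
Proof.
move=> hd cK Kd sF F0 c hc k; apply: Ck_local => x cx.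
have [dx|ndx] := pselect (chart_dom d (chart_inv c x)).
  pose P := chart_cod c `&` chart_inv c @^-1` chart_dom d.
  have oP : open P by apply: open_chart_inv_preimage; exact: chart_dom_open.
  exists P => //.
  have Pd y : P y -> chart_cod d ((d \o chart_inv c) y).
    by move=> [_ dy]; exact: chart_to_cod.
  have := Ck_comp oP Pd (charts_compatible c d hc hd k) (sF k).
  by apply: Ck_ext => // y [_ dy] /=; rewrite asboolT.
pose A := ~` (chart_inv d @` K).
have oA : open A.
  rewrite openC; apply: (compact_closed manifold_hausdorff).
  apply: continuous_compact cK; apply: continuous_in_subspaceT => y.
  by rewrite inE => /Kd; exact: chart_inv_cont.
have oP := open_chart_inv_preimage (c := c) oA.
exists (chart_cod c `&` chart_inv c @^-1` A).
  by split=> // -[y Ky yx]; apply: ndx; rewrite -yx; apply/chart_inv_dom/Kd.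
apply: Ck_ext oP _ (Ck_cst _ _ 0) => y [cy Ay] /=.
case: asboolP => // dy; rewrite F0// => Ky; apply: Ay.
by exists (d (chart_inv c y)) => //; exact: chart_toK.
Qed.

(** The test function is a bump around 1 times the [j]-th coordinate centred at 1; its derivative at
    1 is [v 0 j] times the positive value of the bump. *)
Lemma lvf_eq0 (R : realType) (n : nat) (G : lieGroupType R n) (v : 'rV[R]_n) :
  (forall f : G -> R, smooth f -> lvf v f 1%g = 0) -> v = 0.
Proof.
move=> v0; apply/rowP => j; rewrite mxE.
pose d : chart R n G := chart_at (1%g : G); pose a := d 1%g.
have hd : charts d by exact: charts_chart_at.
have da : chart_cod d a by apply: chart_to_cod; exact: chart_at_dom.
have na : nbhs a (chart_cod d) by apply: open_nbhs_nbhs; split=> //; exact: chart_cod_open.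
have [r rd] : exists r : {posnum R}, closed_ball a r%:num `<=` chart_cod d.
  exact/nbhs_closedballP.
(* [q] is positive on a Euclidean ball, which lies in the closed ball of the supremum norm; unlike
   that norm, the sum of squares is smooth. *)
pose q (y : 'rV[R]_n) : R := r%:num ^+ 2 - \sum_(i < n) (y 0 i - a 0 i) ^+ 2.
pose F (y : 'rV[R]_n) : R := expinv 0 (q y) *: (y 0 j - a 0 j).
have Cid k : Ck k (chart_cod d) (id : 'rV[R]_n -> 'rV[R]_n).
  case: k => [|k]; first by move=> x _; exact: cvg_id.
  split=> [x _|w]; first by [].
  have -> : (fun x : 'rV[R]_n => 'D_w id x) = (fun=> w).
    by apply/funext => x; exact: derive_id.
  exact: Ck_cst.
have oc := @chart_cod_open _ _ _ d.
have Cc k i : Ck k (chart_cod d) (fun y : 'rV[R]_n => y 0 i - a 0 i).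
  exact: CkD oc (Ck_coord i oc (Cid k)) (Ck_cst _ _ _).
have Cq k : Ck k (chart_cod d) q.
  have CS : Ck k (chart_cod d) (fun y : 'rV[R]_n => \sum_(i < n) (y 0 i - a 0 i) ^+ 2).
    by apply: Ck_sum => // i; have := CkZ oc (Cc k i) (Cc k i).
  have := CkD oc (Ck_cst k _ (r%:num ^+ 2)) (CkZ oc (Ck_cst k _ (-1 : R)) CS).
  by apply: Ck_ext => // y _; rewrite /q scaleN1r.
have CF k : Ck k (chart_cod d) F by apply: CkZ => //; exact: Ck_expinv.
have FK y : ~ closed_ball a r%:num y -> F y = 0.
  move=> nK; rewrite /F /expinv; case: ifPn => q0; last by rewrite scale0r.
  exfalso; apply: nK; rewrite closed_ballE//= /closed_ball_/= -opprB normrN.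
  rewrite [`|_|]mx_normrE; apply/bigmax_leP; split=> // -[i0 i] _ /=.
  rewrite ord1 !mxE -(ler_pXn2r (_ : 0 < 2)%N) ?nnegrE//.
  rewrite real_normK ?num_real//.
  move: q0; rewrite /q subr_gt0 => /ltW; apply: le_trans.
  by rewrite (bigD1 i)//= lerDl sumr_ge0// => i' _; exact: sqr_ge0.
have cK : compact (closed_ball a r%:num).
  apply: bounded_closed_compact; last exact: closed_ball_closed.
  exists (`|a| + r%:num); split; first exact: num_real.
  move=> M aM y; rewrite closed_ballE//= /closed_ball_/= => ay.
  apply: le_trans (ltW aM); rewrite -[y](subKr a) (le_trans (ler_normB _ _))//.
  by rewrite lerD2l.
have := v0 _ (smooth_extend0 hd cK rd CF FK).
have -> : lvf v (fun p : G => if `[< chart_dom d p >] then F (d p) else 0) 1%g = 'D_v F a.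
  apply: near_eq_derive; apply: filterS na => y dy.
  by rewrite mul1g asboolT ?chart_invK//; exact: chart_inv_dom.
have [dc _] := Cc 1%N j; have [dq _] := Ck_expinv 0 oc (Cq 1%N).
have dF := is_diff_scale (dq a da) (dc a da).
rewrite deriveE; last by have [] := dF.
(* The coordinate factor vanishes at [a], so one term of the product rule survives. *)
rewrite diff_val subrr scaler0 add0r -deriveE; last exact: dc.
have -> : 'D_v (fun y : 'rV[R]_n => y 0 j - a 0 j) a = v 0 j.
  have did : derivable (id : 'rV[R]_n -> 'rV[R]_n) a v by exact: derivable_id.
  rewrite deriveB; last 2 first.
  - by have /derivable_mxP/(_ 0 j) := did.
  - exact: derivable_cst.
  rewrite derive_cst subr0.
  have := derive_mx did; rewrite derive_id => /matrixP/(_ 0 j).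
  by rewrite mxE.
move=> /eqP; rewrite mulf_eq0 => /orP[|/eqP//].
rewrite /q big1 => [|i _]; last by rewrite subrr expr0n.
by rewrite subr0 /expinv exprn_gt0// expr0 invr1 mul1r expR_eq0.
Qed.

(** * The bracket and the layers *)

Section LieGroupDerivatives.
Context {R : realType} {n : nat} {G : lieGroupType R n}.

Lemma differentiable_lmul_chart {U : normedModType R} (f : G -> U) p : smooth f ->
  differentiable (fun y => f (p * chart_inv (chart_at (1%g : G)) y)%g)
    (chart_at (1%g : G) 1%g).
Proof.
move=> sf; have [df _] := smooth_mul_l p (charts_chart_at (1%g : G)) sf 1%N.
by apply: df; apply: chart_to_cod; exact: chart_at_dom.
Qed.

Lemma lvf_linear {U : normedModType R} (a : R) (v w : 'rV[R]_n) (f : G -> U) :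
  smooth f -> lvf (a *: v + w) f = a *: lvf v f + lvf w f.
Proof.
move=> sf; apply/funext => p; have df := differentiable_lmul_chart p sf.
by rewrite -[RHS]/(a *: lvf v f p + lvf w f p) /lvf !deriveE// linearP.
Qed.

Lemma lvfB {U : normedModType R} (v : 'rV[R]_n) (f g : G -> U) :
  smooth f -> smooth g -> lvf v (f - g) = lvf v f - lvf v g.
Proof.
move=> sf sg; have := lvf_comb (-1) v sg sf.
by rewrite !scaleN1r addrC => ->; rewrite addrC.
Qed.

Lemma smooth_comp_linear {U U' : normedModType R} (L : {linear U -> U'}) (f : G -> U) :
  continuous L -> smooth f -> smooth (L \o f).
Proof.
move=> cL sf c hc k; have := Ck_linear (@chart_cod_open _ _ _ c) cL (sf c hc k).
exact.
Qed.

Lemma lvf_comp_linear {U U' : normedModType R} (L : {linear U -> U'}) v (f : G -> U) :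
  continuous L -> smooth f -> lvf v (L \o f) = L \o lvf v f.
Proof.
move=> cL sf; apply/funext => p; have df := differentiable_lmul_chart p sf.
have dL y : differentiable L y by exact: linear_differentiable.
rewrite /lvf /= deriveE; last by apply: (@differentiable_comp _ _ _ _ _ L).
by rewrite (@diff_comp _ _ _ _ _ L)//= diff_lin// deriveE.
Qed.

(** Transfers identities between derivations of real functions to the Lie algebra. *)
Lemma lvf_inj (v w : 'rV[R]_n) :
  (forall f : G -> R, smooth f -> lvf v f 1%g = lvf w f 1%g) -> v = w.
Proof.
move=> vw; apply/eqP; rewrite eq_sym -subr_eq0 -scaleN1r addrC; apply/eqP.
apply: (@lvf_eq0 R n G) => f sf; rewrite lvf_linear//.
by rewrite -[LHS]/(-1 *: lvf v f 1%g + lvf w f 1%g) vw// scaleN1r addNr.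
Qed.

Variable br : 'rV[R]_n -> 'rV[R]_n -> 'rV[R]_n.
Hypothesis hbr : is_lie_bracket G br.

Lemma lvf_br v w (f : G -> R) : smooth f ->
  lvf (br v w) f = lvf v (lvf w f) - lvf w (lvf v f).
Proof. by move=> sf; apply/funext => p; rewrite (hbr v w sf). Qed.

Lemma br_antisym v w : br v w = - br w v.
Proof.
have -> : - br w v = -1 *: br w v + 0 by rewrite scaleN1r addr0.
apply: lvf_inj => f sf; rewrite [in RHS]lvf_linear//.
have lvf0 : lvf 0 f 1%g = 0 by rewrite /lvf derive0.
rewrite -[RHS]/(-1 *: lvf (br w v) f 1%g + lvf 0 f 1%g) lvf0 addr0 scaleN1r.
by rewrite !hbr// opprB.
Qed.

Lemma br_linearl a u v w : br (a *: u + v) w = a *: br u w + br v w.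
Proof.
apply: lvf_inj => f sf; have sL z : smooth (lvf z f) by exact: smooth_lvf.
rewrite lvf_linear// lvf_br// !lvf_linear// lvf_comb//.
rewrite -[RHS]/(a *: lvf (br u w) f 1%g + lvf (br v w) f 1%g) !hbr//.
set A := lvf u (lvf w f); set B := lvf v (lvf w f).
set C := lvf w (lvf u f); set D := lvf w (lvf v f).
rewrite -[LHS]/(a * A 1%g + B 1%g - (a * C 1%g + D 1%g)) /GRing.scale/=.
by ring.
Qed.

Lemma br_linearr a u v w : br w (a *: u + v) = a *: br w u + br w v.
Proof. by rewrite br_antisym br_linearl opprD -scalerN -!br_antisym. Qed.

(** Each double bracket acts on [f] as a signed sum of four third-order derivatives, and these
    cancel. *)
Lemma br_jacobi u v w : br (br u v) w = br u (br v w) - br v (br u w).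
Proof.
apply: lvf_inj => f sf; have sL z : smooth (lvf z f) by exact: smooth_lvf.
have sLL y z : smooth (lvf y (lvf z f)) by exact: smooth_lvf.
have -> : br u (br v w) - br v (br u w) = -1 *: br v (br u w) + br u (br v w).
  by rewrite scaleN1r addrC.
rewrite (lvf_linear (-1))//.
have -> : lvf (br (br u v) w) f = lvf u (lvf v (lvf w f)) - lvf v (lvf u (lvf w f)) -
    (lvf w (lvf u (lvf v f)) - lvf w (lvf v (lvf u f))).
  by rewrite lvf_br// lvf_br// (lvf_br u v sf) lvfB.
have -> : lvf (br u (br v w)) f = lvf u (lvf v (lvf w f)) - lvf u (lvf w (lvf v f)) -
    (lvf v (lvf w (lvf u f)) - lvf w (lvf v (lvf u f))).
  by rewrite lvf_br// (lvf_br v w (sL u)) (lvf_br v w sf) lvfB.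
have -> : lvf (br v (br u w)) f = lvf v (lvf u (lvf w f)) - lvf v (lvf w (lvf u f)) -
    (lvf u (lvf w (lvf v f)) - lvf w (lvf u (lvf v f))).
  by rewrite lvf_br// (lvf_br u w (sL v)) (lvf_br u w sf) lvfB.
have alg (a b c d e g : R) :
    a - b - (c - d) = -1 * (b - e - (g - c)) + (a - g - (e - d)) by ring.
exact: alg.
Qed.

Lemma br0r v : br v 0 = 0.
Proof. by apply: (linear_fun0 (f := br v)) => a x y; exact: br_linearr. Qed.

Variables (s : nat) (V : nat -> {vspace 'rV[R]_n}).
Hypothesis hG : stratified G br s V.

(** For [a + b <= s] the stratification only gives the brackets with [V 1]. By induction on [a], the
    Jacobi identity rewrites [br (br u v) w], with [u] in [V 1], into brackets whose left entry is
    [u] or [v]. *)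
Lemma br_layer a b v w : (1 <= a <= s)%N -> (1 <= b <= s)%N -> v \in V a -> w \in V b ->
  if (a + b <= s)%N then br v w \in V (a + b)%N else br v w == 0.
Proof.
case: a => // a /= als hb va wb; case: ifPn => [|abs]; last first.
  by apply/eqP; apply: (stratified_nilpotent hG) va wb => //; rewrite ltnNge.
elim: a => [|a IH] in als b hb v va w wb *.
  rewrite add1n => bs; apply: (stratified_generate hG _ (V b.+1)).1 => //.
  by case/andP: hb => -> _.
move=> abs.
(* The good [v] form a subspace, so by minimality of the layer it suffices to treat the generating
   brackets. *)
have [||X XP] := @ex_vspace R _ (fun v : 'rV[R]_n => br v w \in V (a.+2 + b)%N).
- by rewrite br_antisym br0r oppr0 mem0v.
- by move=> c x y Px Py; rewrite br_linearl rpredD// rpredZ.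
apply/XP; move: (v) va; apply/subvP.
apply/(stratified_generate hG _ X) => // u {}v u1 va; apply/XP.
rewrite br_jacobi.
have h1 b' v' w' : (1 <= b')%N -> (b' < s)%N -> v' \in V 1%N -> w' \in V b' -> br v' w' \in V b'.+1.
  move=> b1 bs v1 wb'; apply: (stratified_generate hG _ (V b'.+1)).1 => //.
  by rewrite b1.
have b1 : (1 <= b)%N by case/andP: hb.
apply: rpredB.
  rewrite addSn; apply: h1 => //.
  by apply: IH => //; apply: ltnW.
have -> : (a.+2 + b = a.+1 + b.+1)%N by rewrite addnS.
apply: IH => //.
- exact: ltnW.
- by apply: leq_trans abs; rewrite addSn ltnS leq_addl.
- by apply: h1 => //; apply: leq_trans abs; rewrite addSn ltnS leq_addl.
- by rewrite addnS.
Qed.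

End LieGroupDerivatives.

(** * Words and jets *)

Lemma ex_words (T : finType) (m : nat) :
  exists s : seq (seq T), forall w, (size w <= m)%N -> w \in s.
Proof.
elim: m => [|m [s IH]]; first by exists [:: [::]] => -[].
exists ([::] :: [seq x :: w | x <- enum T, w <- s]) => -[|x w]//= wm.
by rewrite inE; apply/orP; right; apply/allpairsP; exists (x, w); rewrite mem_enum IH.
Qed.

Section WordDerivatives.
Context {R : realType} {n : nat} {G : lieGroupType R n}.
Context {V1 : {vspace 'rV[R]_n}} {U : normedModType R}.
Implicit Types (f : G -> U) (p : G) (w : seq (subvs_of V1)) (A : seq (subvs_of V1) -> U).

(** [hder_word] as a function of the point, so that it can be differentiated again. *)
Definition wder f w : G -> U := foldl (fun h v => lvf (vsval v) h) f w.

Lemma wder_cat f w1 w2 : wder f (w1 ++ w2) = wder (wder f w1) w2.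
Proof. by rewrite /wder foldl_cat. Qed.

Lemma smooth_wder f w : smooth f -> smooth (wder f w).
Proof. by elim: w f => [|v w IH] f sf //=; apply/IH/smooth_lvf. Qed.

Lemma wder0 w : wder (fun=> 0) w = fun=> 0.
Proof.
elim: w => [|v w IH] //; rewrite -[RHS]IH.
suff e0 : lvf (vsval v) (fun _ : G => 0 : U) = fun=> 0 by rewrite /wder/= e0.
by apply/funext => x; exact: derive_cst.
Qed.

(** Words replace tuples, so that concatenation needs no casts. The pair [f], [p] may depend on the
    degree. *)
Lemma HDleP m A : A \in HDle_pred G m <->
  (forall k, (k <= m)%N -> exists f p, smooth f /\
     forall w, size w = k -> A w = wder f w p) /\
  (forall w, (m < size w)%N -> A w = 0).
Proof.
rewrite inE; split=> -[H1 H2]; split.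
- move=> k /H1[f [p [sf fp]]]; exists f, p; split=> // w wk.
  have ws : size w == k by exact/eqP.
  exact: (congr1 (fun h => h (Tuple ws)) fp).
- move=> w /H2 /(congr1 (fun h => h (in_tuple w))) //.
- move=> k /H1[f [p [sf fp]]]; exists f, p; split=> //.
  by apply/funext => t; rewrite /component fp// size_tuple.
- by move=> k mk; apply/funext => t; rewrite /component H2// size_tuple.
Qed.

Lemma HDle_multilinear m A a (u v : subvs_of V1) w1 w2 : A \in HDle_pred G m ->
  A (w1 ++ (a *: u + v) :: w2) = a *: A (w1 ++ u :: w2) + A (w1 ++ v :: w2).
Proof.
move=> /HDleP[HA A0].
have sz x : size (w1 ++ x :: w2) = (size w1 + (size w2).+1)%N by rewrite size_cat.
have [wm|wm] := leqP (size w1 + (size w2).+1) m; last first.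
  by rewrite !A0 ?sz// scaler0 addr0.
have [f [p [sf fp]]] := HA _ wm.
have sw := smooth_wder w1 sf.
have vsL : vsval (a *: u + v) = a *: vsval u + vsval v by exact: linearP.
rewrite !fp// !wder_cat -[LHS]/(wder (lvf (vsval (a *: u + v)) (wder f w1)) w2 p).
by rewrite vsL lvf_linear// /wder foldl_lvf_comb//; exact: smooth_lvf.
Qed.

(** By multilinearity the letters can be expanded in a basis one after the other, so finitely many
    values determine an element. *)
Lemma HDle_eq0 m A : A \in HDle_pred G m ->
  let b := vbasis (fullv : {vspace (subvs_of V1)}) in
  (forall w : seq 'I_(\dim (fullv : {vspace (subvs_of V1)})), (size w <= m)%N ->
     A [seq b`_(i : 'I__) | i <- w] = 0) ->
  A = 0.
Proof.
move=> HA b Ab; have [_ A0] := (HDleP m A).1 HA.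
suff H w2 (w1 : seq 'I_(\dim (fullv : {vspace (subvs_of V1)}))) :
    A ([seq b`_(i : 'I__) | i <- w1] ++ w2) = 0.
  by apply/funext => w; exact: (H w [::]).
elim: w2 w1 => [|u w2 IH] w1.
  rewrite cats0; have [/Ab//|wm] := leqP (size w1) m.
  by rewrite A0// size_map.
set w := map _ _.
have AL a x y : A (w ++ (a *: x + y) :: w2) = a *: A (w ++ x :: w2) + A (w ++ y :: w2).
  exact: HDle_multilinear HA.
have Az : A (w ++ 0 :: w2) = 0 by exact: linear_fun0 AL.
rewrite (coord_vbasis (memvf u)); elim/big_rec: _ => // i y _ Ay.
rewrite AL Ay addr0 -/b.
have -> : w ++ b`_i :: w2 = [seq b`_(j : 'I__) | j <- rcons w1 i] ++ w2.
  by rewrite map_rcons cat_rcons.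
by rewrite IH scaler0.
Qed.

End WordDerivatives.

(** * Right contraction by one vector of [V1] *)

Section Contraction.
Context {R : realType} {n : nat} {G : lieGroupType R n}.
Context {V1 : {vspace 'rV[R]_n}} {W : vectType R}.
Local Notation U := (fdnormed W).
Local Notation word := (seq (subvs_of V1)).

Definition fdcoordi (i : 'I_(\dim (fullv : {vspace W}))) (x : U) : R := fdcoord x 0 i.

Lemma fdcoordi_linear i : linear (fdcoordi i).
Proof. by move=> a x y; rewrite /fdcoordi linearP !mxE. Qed.

HB.instance Definition _ i :=
  GRing.isLinear.Build R U R _ (fdcoordi i) (fdcoordi_linear i).

Lemma fdcoordi_continuous i : continuous (fdcoordi i).
Proof.
move=> x; apply: (iffRL (@cvgrPdist_le R R U (nbhs x) _ (fdcoordi i) (fdcoordi i x))) => e e0.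
apply/nbhs_ballP; exists e => // y.
rewrite -ball_normE/= => /ltW; rewrite -linearB; apply: le_trans.
rewrite [leRHS]mx_normrE.
exact: (le_bigmax _ (fun ij => `|fdcoord (x - y) ij.1 ij.2|) (0, i)).
Qed.

Lemma fdcoordi_eq0 (x : U) : (forall i, fdcoordi i x = 0) -> x = 0.
Proof.
move=> x0; rewrite [LHS](coord_vbasis (memvf (x : W))) big1// => i _.
by have := x0 i; rewrite /fdcoordi mxE => ->; rewrite scale0r.
Qed.

(* [A(w v)] is the limit of the difference quotients, in the parameter of the
   curve, of jets of the same function along a curve with velocity [v]. *)
Lemma HDle_rcons m (A : word -> U) (v : subvs_of V1) : A \in HDle_pred G m ->
  (fun w => A (rcons w v)) \in HDle_pred G m.
Proof.
move=> HA; have [jetA A0] := (HDleP m A).1 HA.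
have /choice[fp fpP] : forall k, exists fp : (G -> U) * G, (k <= m)%N ->
    smooth fp.1 /\ forall w, size w = k -> A w = wder fp.1 w fp.2.
  move=> k; have [/jetA[f [p fpP]]|_] := leqP k m; first by exists (f, p).
  by exists (fun=> 0, 1%g).
(* In degree [k], [Q q] differentiates the function that represents [A] in degree [k.+1], at the
   point [q k]. Degree [m] is set to 0, as [A] vanishes in degree [m.+1]. *)
pose Q (q : nat -> G) (w : word) : U :=
  if (size w < m)%N then wder (fp (size w).+1).1 w (q (size w)) else 0.
have HQ q : Q q \in HDle_pred G m.
  apply/HDleP; split=> [k km|w mw]; last by rewrite /Q ltnNge ltnW.
  have [lt|] := ltnP k m; last first.
    move=> l; exists (fun=> 0), 1%g; split; first exact: smooth_cst.
    by move=> w wk; rewrite /Q wk ltnNge l/= wder0.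
  exists (fp k.+1).1, (q k); split; first by have [] := fpP _ lt.
  by move=> w wk; rewrite /Q wk lt.
pose d : chart R n G := chart_at (1%g : G).
pose D (h : R) : word -> U :=
  h^-1 *: (Q (fun k => (fp k.+1).2 * chart_inv d (h *: vsval v + d 1%g))%g -
           Q (fun k => (fp k.+1).2)).
have [s sP] := ex_words 'I_(\dim (fullv : {vspace (subvs_of V1)})) m.
pose b := vbasis (fullv : {vspace (subvs_of V1)}).
(* The separating functionals are the coordinates of the values at basis words of size at most
   [m]. *)
apply: (@pointwise_closed R word U
  (seq 'I_(\dim (fullv : {vspace (subvs_of V1)})) * 'I_(\dim (fullv : {vspace W})))%type
  (fun wi => fdcoordi wi.2) (fun wi => [seq b`_(i : 'I__) | i <- wi.1])
  [set A | A \in HDle_pred G m] _ _ _ _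
  [seq (w, i) | w <- s, i <- enum 'I_(\dim (fullv : {vspace W}))] _ R (0 : R)^' _ D).
- by move=> i; exact: fdcoordi_linear.
- by move=> i; exact: fdcoordi_continuous.
- exact: rpred0.
- by move=> a B C HB HC; apply: rpredD => //; exact: rpredZ.
- move=> B HB B0; apply: HDle_eq0 HB _ => w /sP ws; apply: fdcoordi_eq0 => i.
  by apply: (B0 (w, i)); apply/allpairsP; exists (w, i); rewrite mem_enum.
- by move=> h; apply: rpredZ; apply: rpredB; exact: HQ.
move=> w; have [wm|wm] := ltnP (size w) m; last first.
  rewrite A0 ?size_rcons//.
  have -> : (fun h => D h w) = fun=> 0.
    apply/funext => h; rewrite /D -[LHS]/(_ *: (Q _ w - Q _ w)) /Q ltnNge wm/=.
    by rewrite subrr scaler0.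
  exact: cvg_cst.
have [sf fA] := fpP _ wm; rewrite fA ?size_rcons// -cats1 wder_cat.
have dl : derivable (fun y => wder (fp (size w).+1).1 w ((fp (size w).+1).2 * chart_inv d y)%g)
    (d 1%g) (vsval v).
  by apply: derivable_lvf; exact: smooth_wder.
apply: cvg_trans dl; apply: near_eq_cvg; near=> h.
rewrite /D -[RHS]/(_ *: (Q _ w - Q _ w)) /Q wm/=.
by rewrite chart_toK ?mulg1//; exact: chart_at_dom.
Unshelve. all: by end_near. Qed.

End Contraction.

(** * Contraction by combinations of words *)

Section WordPolynomials.
Context {R : realType} {n : nat} {G : lieGroupType R n}.
Context {V1 : {vspace 'rV[R]_n}} {W : vectType R}.
Local Notation U := (fdnormed W).
Local Notation word := (seq (subvs_of V1)).
Implicit Types (P : seq (R * word)) (A : word -> U) (f : G -> U) (p : G).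

(** [P] is a formal linear combination of words, standing for an element of the tensor algebra of
    [V1]. *)
Definition contract P A : word -> U := fun x => \sum_(cu <- P) cu.1 *: A (x ++ cu.2).

Lemma contract_comb P a A B : contract P (a *: A + B) = a *: contract P A + contract P B.
Proof.
apply/funext => x; rewrite -[RHS]/(a *: contract P A x + contract P B x).
rewrite /contract scaler_sumr -big_split/=; apply: eq_bigr => cu _.
by rewrite -[(a *: A + B) _]/(a *: A _ + B _) scalerDr !scalerA mulrC.
Qed.

Lemma contract_HDle m P A : A \in HDle_pred G m -> contract P A \in HDle_pred G m.
Proof.
move=> HA; elim: P => [|[c u] P IH].
  by have -> : contract [::] A = 0; [apply/funext => x; rewrite /contract big_nil|exact: rpred0].
have -> : contract ((c, u) :: P) A = c *: (fun x => A (x ++ u)) + contract P A.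
  by apply/funext => x; rewrite /contract big_cons.
apply: rpredD => //; apply: rpredZ.
(* The letters of [u] are appended one by one, each by [HDle_rcons]. *)
elim: u {IH} => [|v u IH]; first by under eq_fun do rewrite cats0.
by under eq_fun do rewrite -cat_rcons; exact: (HDle_rcons v IH).
Qed.

Lemma lvf_sum v P f : smooth f ->
  lvf v (fun p => \sum_(cu <- P) cu.1 *: wder f cu.2 p) =
  fun p => \sum_(cu <- P) cu.1 *: lvf v (wder f cu.2) p.
Proof.
move=> sf; suff [] : smooth (fun p => \sum_(cu <- P) cu.1 *: wder f cu.2 p) /\
  lvf v (fun p => \sum_(cu <- P) cu.1 *: wder f cu.2 p) =
  fun p => \sum_(cu <- P) cu.1 *: lvf v (wder f cu.2) p by [].
elim: P => [|[c u] P [sP IH]].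
  under eq_fun do rewrite big_nil; split; first exact: smooth_cst.
  by apply/funext => p; rewrite big_nil; exact: derive_cst.
have -> : (fun p => \sum_(cu <- (c, u) :: P) cu.1 *: wder f cu.2 p) =
    c *: wder f u + (fun p => \sum_(cu <- P) cu.1 *: wder f cu.2 p).
  by apply/funext => p; rewrite big_cons.
have su := smooth_wder u sf; split; first exact: smooth_comb.
by rewrite lvf_comb// IH; apply/funext => p; rewrite big_cons.
Qed.

Definition represents l (v : 'rV[R]_n) P : Prop :=
  (forall cu, cu \in P -> size cu.2 = l) /\
  forall f, smooth f -> lvf v f = fun p => \sum_(cu <- P) cu.1 *: wder f cu.2 p.

(** The words of [P] come after [x], so they differentiate [wder f x]. The result depends on [v] but
    not on [P]. *)
Lemma contractE l v P A f p (x : word) : represents l v P -> smooth f ->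
  (forall w, size w = (size x + l)%N -> A w = wder f w p) ->
  contract P A x = lvf v (wder f x) p.
Proof.
move=> [Pl Pv] sf Af; rewrite Pv; last exact: smooth_wder.
apply: eq_big_seq => cu /Pl cul.
by rewrite Af ?wder_cat// size_cat cul.
Qed.

Lemma contract_eq0 l v P A m (x : word) : represents l v P -> A \in HDle_pred G m ->
  (m < size x + l)%N -> contract P A x = 0.
Proof.
move=> [Pl _] /HDleP[_ A0] mx; apply: big1_seq => cu /Pl cul.
by rewrite A0 ?scaler0// size_cat cul.
Qed.

(* The composition of contractions reverses the order of the derivations, which
   is why the extension is an anti-morphism. *)
Lemma contract2E a b v w P Q A f p (x : word) :
  represents a v P -> represents b w Q -> smooth f ->
  (forall y, size y = (size x + a + b)%N -> A y = wder f y p) ->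
  contract P (contract Q A) x = lvf w (lvf v (wder f x)) p.
Proof.
move=> [Pl Pv] rQ sf Af; rewrite Pv; last exact: smooth_wder.
rewrite lvf_sum; last exact: smooth_wder.
apply: eq_big_seq => cu /Pl cul.
rewrite (contractE rQ sf (p := p)) ?wder_cat// => y ys.
by apply: Af; rewrite ys size_cat cul.
Qed.

Lemma contract2_eq0 a b v w P Q A m (x : word) :
  represents a v P -> represents b w Q -> A \in HDle_pred G m ->
  (m < size x + a + b)%N -> contract P (contract Q A) x = 0.
Proof.
move=> [Pl _] rQ HA mx; apply: big1_seq => cu /Pl cul.
by rewrite (contract_eq0 rQ HA) ?scaler0// size_cat cul.
Qed.

Variable br : 'rV[R]_n -> 'rV[R]_n -> 'rV[R]_n.
Hypothesis hbr : is_lie_bracket G br.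

(** The bracket is specified by real functions only. Coordinates are continuous and linear, hence
    commute with [lvf], and they separate points. *)
Lemma lvf_br_fd v w f : smooth f ->
  lvf (br v w) f = lvf v (lvf w f) - lvf w (lvf v f).
Proof.
move=> sf; apply/funext => p; apply/eqP; rewrite -subr_eq0; apply/eqP.
apply: fdcoordi_eq0 => i; have ci := @fdcoordi_continuous _ W i.
have L z (g : G -> U) : smooth g -> fdcoordi i (lvf z g p) = lvf z (fdcoordi i \o g) p.
  by move=> sg; rewrite lvf_comp_linear.
have L' z (g : G -> U) : smooth g -> fdcoordi i \o lvf z g = lvf z (fdcoordi i \o g).
  by move=> sg; rewrite lvf_comp_linear.
have fB (x y : U) : fdcoordi i (x - y) = fdcoordi i x - fdcoordi i y by exact: linearB.
pose F := fdcoordi i \o f; have sF : smooth F by exact: smooth_comp_linear.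
have E1 : fdcoordi i (lvf (br v w) f p) = lvf v (lvf w F) p - lvf w (lvf v F) p.
  exact: etrans (L _ _ sf) (hbr v w sF p).
have E2 y z : fdcoordi i (lvf y (lvf z f) p) = lvf y (lvf z F) p.
  exact: etrans (L _ _ (smooth_lvf z sf)) (congr1 (fun g => lvf y g p) (L' _ _ sf)).
have E3 : fdcoordi i (lvf v (lvf w f) p - lvf w (lvf v f) p) =
    lvf v (lvf w F) p - lvf w (lvf v F) p.
  have sub2 (x y x' y' : R) : x = x' -> y = y' -> x - y = x' - y' by move=> -> ->.
  exact: etrans (fB _ _) (sub2 _ _ _ _ (E2 v w) (E2 w v)).
apply: etrans (fB _ (lvf v (lvf w f) p - lvf w (lvf v f) p)) _.
by apply/eqP; rewrite subr_eq0; apply/eqP; exact: etrans E1 (esym E3).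
Qed.

Variables (s : nat) (V : nat -> {vspace 'rV[R]_n}).
Hypothesis hG : stratified G br s V.
Hypothesis V1E : V1 = V 1%N.

(** Induction on the layer: the represented vectors form a subspace that contains the generating
    brackets. *)
Lemma ex_represents l v : (1 <= l <= s)%N -> v \in V l -> exists P, represents l v P.
Proof.
case: l => // l /= ls; elim: l => [|l IH] in ls v *.
  rewrite -V1E => v1; exists [:: (1, [:: vsproj V1 v])]; split.
    by move=> cu; rewrite inE => /eqP->.
  by move=> f sf; apply/funext => p; rewrite big_seq1 scale1r /wder/= vsprojK.
have [||X XP] := @ex_vspace R _ (fun v : 'rV[R]_n => exists P, represents l.+2 v P).
- exists [::]; split=> // f sf; apply/funext => p.
  by rewrite big_nil /lvf derive0.
- move=> a u w [P [Pl PE]] [Q [Ql QE]].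
  exists ([seq (a * cu.1, cu.2) | cu <- P] ++ Q); split.
    by move=> cu; rewrite mem_cat => /orP[/mapP[du /Pl dul ->]|/Ql].
  move=> f sf; rewrite lvf_linear// PE// QE//; apply/funext => p.
  rewrite big_cat big_map/=; under [in RHS]eq_bigr do rewrite -scalerA.
  by rewrite -scaler_sumr.
move=> v2; apply/XP; move: (v) v2; apply/subvP.
apply/(stratified_generate hG _ X); first exact: ls.
move=> u {}v; rewrite -V1E => u1 /IH[|P [Pl PE]]; first exact: ltnW.
apply/XP; pose u' := vsproj V1 u; have uE : vsval u' = u by rewrite vsprojK.
(* The first letter differentiates first: [u] goes to the end of each word for [lvf u (lvf v f)],
   and to its head, with a minus sign, for [lvf v (lvf u f)]. *)
exists ([seq (cu.1, rcons cu.2 u') | cu <- P] ++ [seq (- cu.1, u' :: cu.2) | cu <- P]).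
split.
  move=> cu; rewrite mem_cat => /orP[] /mapP[du /Pl dul ->] /=; last by rewrite dul.
  by rewrite size_rcons dul.
move=> f sf; rewrite lvf_br_fd// (PE f)// lvf_sum// PE; last exact: smooth_lvf.
apply/funext => p; rewrite big_cat !big_map/=; congr (_ + _).
  by apply: eq_bigr => cu _; rewrite -cats1 wder_cat /wder/= uE.
rewrite -[LHS]/(- (\sum_(cu <- P) cu.1 *: wder (lvf u f) cu.2 p)) -sumrN.
apply: eq_bigr => cu _.
by rewrite scaleNr /wder/= uE.
Qed.

Lemma layer_ind (Pr : 'rV[R]_n -> Prop) : Pr 0 ->
  (forall a u v, Pr u -> Pr v -> Pr (a *: u + v)) ->
  (forall l v, (1 <= l <= s)%N -> v \in V l -> Pr v) -> forall v, Pr v.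
Proof.
move=> Pr0 PrD PrV v; have [X XP] := ex_vspace Pr0 PrD.
apply/XP; have : v \in fullv by exact: memvf.
rewrite -(stratified_full hG); apply: subvP; apply/subv_sumP => i _.
by apply/subvP => u /PrV Pu; apply/XP/Pu; rewrite ltn_ord.
Qed.

Variable rep : nat -> 'rV[R]_n -> seq (R * word).
Hypothesis repP : forall l v, (1 <= l <= s)%N -> v \in V l -> represents l v (rep l v).
Variable m : nat.

(** The choice [rep] need not be linear in the vector: up to total degree [m] the contraction is a
    left-invariant derivative, which is linear, and beyond it all terms vanish. *)
Lemma contract_rep_linear l a u v A : (1 <= l <= s)%N -> u \in V l -> v \in V l ->
  A \in HDle_pred G m ->
  contract (rep l (a *: u + v)) A = a *: contract (rep l u) A + contract (rep l v) A.
Proof.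
move=> ls ul vl HA; have uvl : a *: u + v \in V l by rewrite rpredD// rpredZ.
apply/funext => x; rewrite -[RHS]/(a *: contract (rep l u) A x + contract (rep l v) A x).
have [xm|mx] := leqP (size x + l) m; last first.
  by rewrite !(contract_eq0 (repP _ _) HA)// scaler0 addr0.
have [f [p [sf Af]]] := ((HDleP m A).1 HA).1 _ xm.
rewrite !(contractE (repP _ _) sf Af)// lvf_linear//; exact: smooth_wder.
Qed.

(** Up to total degree [m] both sides are the derivative of [wder f x] along [br v w]; beyond it
    both vanish. For [s < a + b] the bracket is 0, whence the value 0. *)
Lemma contract_rep_br a b v w A : (1 <= a <= s)%N -> (1 <= b <= s)%N ->
  v \in V a -> w \in V b -> A \in HDle_pred G m ->
  (if (a + b <= s)%N then contract (rep (a + b) (br v w)) A else 0) =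
  - (contract (rep a v) (contract (rep b w) A) - contract (rep b w) (contract (rep a v) A)).
Proof.
move=> ha hb va wb HA; have := br_layer hbr hG ha hb va wb.
have abs1 : (a + b <= s)%N -> (1 <= a + b <= s)%N.
  by move=> ->; rewrite andbT addn_gt0; case/andP: ha => ->.
have [rv rw] := (repP ha va, repP hb wb).
move=> brl; apply/funext => x.
rewrite -[RHS]/(- (contract _ _ x - contract _ _ x)).
have [xm|mx] := leqP (size x + a + b) m; last first.
  rewrite (contract2_eq0 rv rw HA mx) (contract2_eq0 rw rv HA) ?subr0 ?oppr0;
    last by rewrite addnAC.
  move: brl; case: ifPn => // abs brl.
  by rewrite (contract_eq0 (repP (abs1 abs) brl) HA)// addnA.
have [f [p [sf Af]]] := ((HDleP m A).1 HA).1 _ xm.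
have sx := smooth_wder x sf.
rewrite (contract2E rv rw sf Af) (contract2E (p := p) rw rv sf); last by rewrite addnAC.
rewrite opprB -[RHS]/((lvf v (lvf w (wder f x)) - lvf w (lvf v (wder f x))) p) -lvf_br_fd//.
move: brl; case: ifPn => [abs brl|abs /eqP ->].
  by apply: contractE (repP (abs1 abs) brl) sf _; rewrite addnA.
by rewrite /lvf derive0.
Qed.

End WordPolynomials.

(** * The extension *)

(** Chain rule for the curve [E (t *: v)] read in the chart at 1, where its velocity at 0 is [v]. *)
Lemma is_derive_lmul_exp (R : realType) (n : nat) (G : lieGroupType R n)
    (U : normedModType R) (E : 'rV[R]_n -> G) (g : G -> U) p v :
  is_lie_exp E -> smooth g ->
  is_derive (0 : R) 1 (fun t => g (p * E (t *: v))%g) (lvf v g p).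
Proof.
move=> hE sg; have [EM [Ec _] Ed] := hE v.
pose d : chart R n G := chart_at (1%g : G).
have E0 : E (0 *: v) = 1%g.
  (* The value at 0 is idempotent. *)
  have := EM 0 0; rewrite addr0 => /(congr1 (fun x => x * (E (0 *: v))^-1)%g).
  by rewrite mulgV mulgK.
pose h y := g (p * chart_inv d y)%g; pose c t := d (E (t *: v)).
have c0 : c 0 = d 1%g by rewrite /c E0.
have dE : nbhs (E (0 *: v)) (chart_dom d).
  rewrite E0; apply: open_nbhs_nbhs; split; [exact: chart_dom_open|exact: chart_at_dom].
have nE : \forall t \near (0 : R), chart_dom d (E (t *: v)) by exact: (Ec 0 _ dE).
apply: (@near_eq_is_derive _ _ _ (h \o c)).
  by near=> t; rewrite /h /c /= chart_toK//; near: t.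
have [dc cv] := Ed.
have {}dc : differentiable c 0 by apply/derivable1_diffP.
have dh : differentiable h (c 0) by rewrite c0; exact: differentiable_lmul_chart.
have dhc : differentiable (h \o c) 0 by exact: differentiable_comp.
apply: DeriveDef; first exact: diff_derivable.
rewrite deriveE// diff_comp//= -(deriveE _ dc) cv c0.
by rewrite /lvf deriveE//; exact: differentiable_lmul_chart.
Unshelve. all: by end_near. Qed.

Section Extension.
Context {R : realType} {n : nat} {G : lieGroupType R n} {W : vectType R}.
Local Notation U := (fdnormed W).
Variables (br : 'rV[R]_n -> 'rV[R]_n -> 'rV[R]_n) (s : nat) (V : nat -> {vspace 'rV[R]_n}).
Hypothesis hbr : is_lie_bracket G br.
Hypothesis hG : stratified G br s V.
Variable m : nat.
Local Notation HDm := (HDle G (V 1%N) U m).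

(** This holds for words of every size: from size [m] on, both sides are 0. *)
Lemma HDle_rcontract (Psi : 'rV[R]_n -> {linear HDm -> HDm}) (v : subvs_of (V 1%N)) A w :
  is_contraction_extension br Psi ->
  HDle_val (Psi (vsval v) A) w = HDle_val A (rcons w v).
Proof.
move=> [_ /(_ v A)[lt eq] _].
have [_ A0] := (HDleP m _).1 (HDle_valP A).
have [_ P0] := (HDleP m _).1 (HDle_valP (Psi (vsval v) A)).
have [wm|wm|wm] := ltngtP (size w) m.
- exact: (congr1 (fun h => h (in_tuple w)) (lt _ wm)).
- by rewrite P0// A0// size_rcons ltnS ltnW.
- rewrite A0 ?size_rcons ?wm//.
  have ws : size w == m by exact/eqP.
  exact: (congr1 (fun h => h (Tuple ws)) eq).
Qed.

(** The values on [V 1] are prescribed, and the bracket identity propagates agreement from layer to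
    layer, because the vectors of agreement form a subspace. *)
Lemma contraction_extension_unique (Phi Psi : 'rV[R]_n -> {linear HDm -> HDm}) :
  is_contraction_extension br Phi -> is_contraction_extension br Psi ->
  forall v A, Psi v A = Phi v A.
Proof.
move=> hPhi hPsi.
have lin0 (Th : 'rV[R]_n -> {linear HDm -> HDm}) A :
    is_contraction_extension br Th -> Th 0 A = 0.
  by move=> [L _ _]; apply: (linear_fun0 (f := Th^~ A)) => a x y; exact: L.
pose Pr v := forall A, Psi v A = Phi v A.
have Pr0 : Pr 0 by move=> A; rewrite !lin0.
have PrD a u v : Pr u -> Pr v -> Pr (a *: u + v).
  move=> Pu Pv A; have [LPhi _ _] := hPhi; have [LPsi _ _] := hPsi.
  by rewrite LPhi LPsi Pu Pv.
apply: (layer_ind hG Pr0 PrD) => -[//|l] v /= ls; elim: l => [|l IH] in ls v *.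
  move=> v1 A; apply/val_inj/funext => w.
  by rewrite -(vsprojK v1) /= !HDle_rcontract.
have [X XP] := ex_vspace Pr0 PrD.
move=> v2; apply/XP; move: (v) v2; apply/subvP.
apply/(stratified_generate hG _ X); first exact: ls.
move=> u {}v u1 vl; apply/XP => A.
have Pv := IH (ltnW ls) v vl.
have Pu : Pr u.
  move=> B; apply/val_inj/funext => w.
  by rewrite -(vsprojK u1) /= !HDle_rcontract.
by have [_ _ ->] := hPhi; have [_ _ ->] := hPsi; rewrite !Pu !Pv.
Qed.

(** A vector acts through its components in the layers, each contracted by a chosen representing
    polynomial. The second clause keeps this description for homogeneous vectors, where it yields
    the derivative formulas. *)
Lemma ex_contraction_extension : exists Phi : 'rV[R]_n -> {linear HDm -> HDm},
  is_contraction_extension br Phi /\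
  forall l v A, (1 <= l <= s)%N -> v \in V l ->
    exists2 P, represents (G := G) (W := W) l v P & HDle_val (Phi v A) = contract P (HDle_val A).
Proof.
have /choice[rep' rep'P] : forall lv : nat * 'rV[R]_n, exists P, (1 <= lv.1 <= s)%N ->
    lv.2 \in V lv.1 -> @represents R n G (V 1%N) W lv.1 lv.2 P.
  move=> [l v]; have [[ls vl]|no] := pselect ((1 <= l <= s)%N /\ v \in V l).
    by have [P PP] := ex_represents (W := W) hbr hG erefl ls vl; exists P.
  by exists [::] => ls vl; case: no.
pose rep l v := rep' (l, v).
have repP l v : (1 <= l <= s)%N -> v \in V l -> represents (G := G) (W := W) l v (rep l v).
  exact: (rep'P (l, v)).
pose pr (i : 'I_s) v := sumv_pi_for (erefl (\sum_(j < s) V j.+1)%VS) i v.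
have prV i v : pr i v \in V i.+1 by exact: memv_sum_pi.
have is1 (i : 'I_s) : (1 <= i.+1 <= s)%N by rewrite ltn_ord.
pose Phi0 v (A : HDm) := \sum_(i < s) contract (rep i.+1 (pr i v)) (HDle_val A).
have Phi0P v A : Phi0 v A \in HDle_pred G m.
  by apply: rpred_sum => i _; apply: contract_HDle; exact: HDle_valP.
pose Phi1 v A : HDm := MkHDle (Phi0P v A).
have Phi1_linear v : linear (Phi1 v).
  move=> a A B; apply: val_inj => /=; rewrite /Phi0 scaler_sumr -big_split/=.
  by apply: eq_bigr => i _; rewrite contract_comb.
pose Phi v : {linear HDm -> HDm} :=
  HB.pack (Phi1 v) (GRing.isLinear.Build _ _ _ _ _ (Phi1_linear v)).
(* The polynomial chosen for 0 may be nonempty, yet it contracts to 0. *)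
have rep0 l (A : seq (subvs_of (V 1%N)) -> U) : (1 <= l <= s)%N ->
    A \in HDle_pred G m -> contract (rep l 0) A = 0.
  move=> ls HA; have := contract_rep_linear repP 1 ls (mem0v _) (mem0v _) HA.
  by rewrite scaler0 addr0 scale1r => /eqP; rewrite -subr_eq subrr eq_sym => /eqP.
have Phi_layer l v A : (1 <= l <= s)%N -> v \in V l ->
    HDle_val (Phi v A) = contract (rep l v) (HDle_val A).
  move=> ls vl; have l0 : (l.-1 < s)%N by case: l ls {vl}.
  have lE : l.-1.+1 = l by case: l ls {vl l0}.
  (* Uniqueness of the decomposition in a direct sum; the layer [l] has index [l.-1]. *)
  have prE (i : 'I_s) : pr i v = if i == Ordinal l0 then v else 0.
    pose vs j := if j == Ordinal l0 then v else 0.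
    have vsV (j : 'I_s) : true -> vs j \in V j.+1.
      by move=> _; rewrite /vs; case: eqP => [->/=|_]; [rewrite lE|exact: mem0v].
    have sE : \sum_j pr j v == \sum_j vs j.
      rewrite -big_mkcond big_pred1_eq; apply/eqP; apply: sumv_pi_sum.
      by rewrite (stratified_full hG); exact: memvf.
    move: sE; rewrite (directv_sum_unique (stratified_direct hG) (pr^~ v) vs)//.
    by move=> /forallP/(_ i)/eqP.
  rewrite /= /Phi0 (bigD1 (Ordinal l0))//= prE eqxx lE big1 ?addr0// => i il.
  by rewrite prE (negbTE il); exact: rep0 (is1 i) (HDle_valP A).
have PhiD a v w A : Phi (a *: v + w) A = a *: Phi v A + Phi w A.
  apply: val_inj => /=; rewrite /Phi0 scaler_sumr -big_split/=.
  apply: eq_bigr => i _; rewrite /pr linearP.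
  exact: (contract_rep_linear repP a (is1 i) (prV i v) (prV i w) (HDle_valP A)).
have Phi00 A : Phi 0 A = 0.
  by apply: (linear_fun0 (f := Phi^~ A)) => a x y; exact: PhiD.
exists Phi; split; last first.
  by move=> l v A ls vl; exists (rep l v); [exact: repP|exact: Phi_layer].
split=> [//|v A|].
  have s1 : (1 <= 1 <= s)%N by rewrite (stratified_step hG).
  have r1 := repP _ _ s1 (subvsP v).
  have [jetA _] := (HDleP m _).1 (HDle_valP A).
  split=> [k km|]; apply/funext => x; rewrite /HDcomp /component (Phi_layer 1%N)//;
    try exact: subvsP.
    have [f [p [sf Af]]] := jetA _ km.
    rewrite (contractE r1 sf (p := p)) ?size_tuple ?addn1//.
    by rewrite /rcontract Af ?size_rcons ?size_tuple//= -cats1 wder_cat.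
  by apply: (contract_eq0 r1 (HDle_valP A)); rewrite size_tuple addn1.
(* [Q] is symmetric and linear in its first argument, which reduces it to homogeneous vectors. *)
pose Q v w := forall A, Phi (br v w) A = - (Phi v (Phi w A) - Phi w (Phi v A)).
suff : forall v w, Q v w by [].
have QC v w : Q v w -> Q w v.
  move=> Qvw A; rewrite (br_antisym hbr) -scaleN1r -[X in Phi X]addr0 PhiD Phi00 addr0.
  by rewrite Qvw scaleN1r opprK opprB.
have Q0 w : Q 0 w.
  move=> A; rewrite (br_antisym hbr) (br0r hbr) oppr0 !Phi00.
  by rewrite -[Phi w 0]/(Phi w (0 : HDm)) linear0 subrr oppr0.
have QD w a u v : Q u w -> Q v w -> Q (a *: u + v) w.
  move=> Qu Qv A; rewrite (br_linearl hbr) !PhiD Qu Qv linearP.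
  by rewrite scalerN -opprD; congr (- _); rewrite scalerBr opprD addrACA.
move=> v w; apply: (layer_ind hG (Pr := Q^~ w)) => //; first by move=> ? ? ?; exact: QD.
move=> a {}v ha va; apply: (QC).
apply: (layer_ind hG (Pr := Q^~ v)) => //; first by move=> ? ? ?; exact: QD.
move=> b {}w hb wb; apply: (QC) => A; apply: val_inj.
have HA := HDle_valP A.
rewrite -[RHS]/(- (HDle_val (Phi v (Phi w A)) - HDle_val (Phi w (Phi v A)))).
rewrite (Phi_layer a v)// (Phi_layer b w A)// (Phi_layer b w)// (Phi_layer a v A)//.
have := contract_rep_br hbr hG repP ha hb va wb HA.
have := br_layer hbr hG ha hb va wb.
case: ifPn => [abs brl <-|_ /eqP -> <-]; last by rewrite Phi00.
by apply: Phi_layer => //; rewrite abs andbT addn_gt0; case/andP: ha => ->.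
Qed.

End Extension.

Theorem proposition3p3 (R : realType) (n : nat) (G : lieGroupType R n)
    (br : 'rV[R]_n -> 'rV[R]_n -> 'rV[R]_n) (E : 'rV[R]_n -> G)
    (s : nat) (V : nat -> {vspace 'rV[R]_n}) (W : vectType R) (m : nat)
    (hbr : is_lie_bracket G br) (hE : is_lie_exp E) (hG : stratified G br s V) :
  exists Phi : 'rV[R]_n -> {linear HDle G (V 1%N) (fdnormed W) m ->
                                   HDle G (V 1%N) (fdnormed W) m},
  [/\ is_contraction_extension br Phi,
      forall Psi : 'rV[R]_n -> {linear HDle G (V 1%N) (fdnormed W) m ->
                                       HDle G (V 1%N) (fdnormed W) m},
        is_contraction_extension br Psi -> forall v A, Psi v A = Phi v A,
      forall (l : nat) (v : 'rV[R]_n) (A : HDle G (V 1%N) (fdnormed W) m),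
        (1 <= l <= s)%N -> v \in V l ->
        (forall k, (k <= m)%N -> (m < k + l)%N ->
           HDcomp (Phi v A) k = (fun=> 0)) /\
        (forall (f : G -> fdnormed W) (p : G), smooth f -> is_jet A f p ->
           forall k, (k + l <= m)%N -> forall x : k.-tuple (subvs_of (V 1%N)),
             is_derive (0 : R) 1 (fun t => hder f (p * E (t *: v))%g k x)
               (HDcomp (Phi v A) k x)) &
      forall (a b : nat) (v w : 'rV[R]_n) (A : HDle G (V 1%N) (fdnormed W) m),
        (1 <= a <= s)%N -> (1 <= b <= s)%N -> v \in V a -> w \in V b ->
        forall (f : G -> fdnormed W) (p : G), smooth f -> is_jet A f p ->
          forall k, (k + a + b <= m)%N ->
          forall x : k.-tuple (subvs_of (V 1%N)),
            is_derive (0 : R) 1 (fun t => hder f (p * E (t *: br v w))%g k x)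
              (HDcomp (Phi w (Phi v A) - Phi v (Phi w A)) k x)].
Proof.
have [Phi [hPhi PhiP]] := ex_contraction_extension (W := W) hbr hG m.
have [_ _ Phi_br] := hPhi.
have jetE (A : HDle G (V 1%N) (fdnormed W) m) f p : is_jet A f p ->
    forall w, (size w <= m)%N -> HDle_val A w = wder f w p.
  by move=> hA w wm; exact: (congr1 (fun h => h (in_tuple w)) (hA _ wm)).
(* On jets, contraction by a homogeneous vector is a left-invariant derivative; both derivative
   formulas rest on this. *)
have PhiE l v (A : HDle G (V 1%N) (fdnormed W) m) f p k (x : k.-tuple _) :
    (1 <= l <= s)%N -> v \in V l -> smooth f -> is_jet A f p -> (k + l <= m)%N ->
    HDcomp (Phi v A) k x = lvf v (wder f x) p.
  move=> ls vl sf hA km; have [P rP E0] := PhiP l v A ls vl.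
  rewrite /HDcomp /component E0; apply: contractE rP sf _ => w ws.
  by apply: (jetE _ _ _ hA); rewrite ws size_tuple.
exists Phi; split=> //.
- by move=> Psi hPsi; exact: (contraction_extension_unique hG hPhi hPsi).
- move=> l v A ls vl; split.
    move=> k km mk; apply/funext => x; have [P rP E0] := PhiP l v A ls vl.
    rewrite /HDcomp /component E0.
    by apply: contract_eq0 rP (HDle_valP A) _; rewrite size_tuple.
  move=> f p sf hA k km x; rewrite (PhiE l v A f p)//.
  exact: (is_derive_lmul_exp p v hE (smooth_wder x sf)).
- move=> a b v w A ha hb va wb f p sf hA k km x.
  (* The anti-morphism identity turns the difference into the contraction by [br v w]. *)
  have -> : Phi w (Phi v A) - Phi v (Phi w A) = Phi (br v w) A by rewrite Phi_br opprB.
  have -> : HDcomp (Phi (br v w) A) k x = lvf (br v w) (wder f x) p.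
    (* If [s < a + b], the bracket is 0 and both sides vanish. *)
    have := br_layer hbr hG ha hb va wb; case: ifPn => [abs brl|_ /eqP ->].
      apply: (PhiE (a + b)%N) => //; last by rewrite addnA.
      by rewrite abs andbT addn_gt0; case/andP: ha => ->.
    have [L _ _] := hPhi.
    have -> : Phi 0 A = 0 by apply: (linear_fun0 (f := Phi^~ A)) => c x1 x2; exact: L.
    by rewrite /lvf derive0.
  exact: (is_derive_lmul_exp p (br v w) hE (smooth_wder x sf)).
Qed.
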